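(* Let $\kappa,T,M>0$ be real numbers. There is a constant $K$, depending only on $T$, $M$ and $\kappa$, such that the following holds. Let $\mathcal{P}$ and $(\mathcal{L}_p)_{p\in\mathcal{P}}$ be sieve data satisfying $\lambda(p)\le Mp^{1/4}$ for all $p\in\mathcal{P}$ and $V(y)\le T\log^{\kappa}y$ for all $y\ge 2$. Let $N$ and $z$ be positive real numbers with $1\le z\le N^{1/4}$, let $\mathcal{S}(N)=\mathcal{S}(N,\mathcal{P},z)$, let $\delta>0$, and let $\mathcal{B}$ be a $\delta$-well spaced subset of $\mathbb{R}/\mathbb{Z}$. Then for any non-zero function $f:\mathcal{B}\to\mathbb{C}$, $$\sum_{n\in\mathcal{S}(N)}\left|\sum_{b\in\mathcal{B}}f(b)e(nb)\right|^2\le K\,\frac{N+\delta^{-1}}{G(z)}\,\log^{\kappa}\left(2\frac{\|f\|_1^2}{\|f\|_2^2}\right)\|f\|_2^2.$$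
   Context: Notation: $e(x)=e^{2\pi i x}$; $\|f\|_1=\sum_{b\in\mathcal{B}}|f(b)|$ and $\|f\|_2^2=\sum_{b\in\mathcal{B}}|f(b)|^2$. Sieve data: $\mathcal{P}$ is a non-empty set of primes, and for each $p\in\mathcal{P}$, $\mathcal{L}_p$ is a non-empty proper subset of $\mathbb{Z}/p\mathbb{Z}$ with cardinality $\lambda(p)$, so $0<\lambda(p)<p$. For $y\ge 2$, $V(y)=\prod_{p<y,\ p\in\mathcal{P}}\left(1-\frac{\lambda(p)}{p}\right)^{-1}$. Let $h$ be the non-negative multiplicative function supported on squarefree positive integers with $h(p)=\frac{\lambda(p)}{p-\lambda(p)}$ for $p\in\mathcal{P}$ and $h(p)=0$ for primes $p\notin\mathcal{P}$. For real $y\ge 1$, $G(y)=\sum_{m\le y}h(m)$, the sum over positive integers $m\leq y$. The sifted set is $$\mathcal{S}(N)=\mathcal{S}(N,\mathcal{P},z)=\{1\le n\le N:\ n \bmod p\notin\mathcal{L}_p \text{ for every } p\in\mathcal{P} \text{ with } p<z\},$$ where $n$ runs over integers. For $x\in\mathbb{R}/\mathbb{Z}$, $\|x\|=\min_{k\in\mathbb{Z}}|x+k|$ is the distance to the nearest integer. A finite set $\mathcal{B}\subseteq\mathbb{R}/\mathbb{Z}$ is $\delta$-well spaced if $\|x-x'\|\ge\delta$ for all distinct $x,x'\in\mathcal{B}$. *)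

(* Defs.v *)
From HB Require Import structures.
From mathcomp Require Import all_boot all_order all_algebra generic_quotient.
From mathcomp Require Import ring_quotient finmap complex.
From mathcomp Require Import all_classical all_reals all_analysis.
From mathcomp Require Import ring lra.

Set Implicit Arguments.
Unset Strict Implicit.
Unset Printing Implicit Defensive.

Import Order.TTheory GRing.Theory Num.Theory.

Local Open Scope classical_set_scope.
Local Open Scope ring_scope.

Section Circle.
Variable R : realType.

Definition int_subgroup : zmodClosed R :=
  GRing.ZmodClosed.clone _ (@Num.int_num_subdef R) _.

(* The group R/Z: the quotient zmodType of R by the predicate Num.int. *)
Definition RmodZ : Type := Quotient.quot int_subgroup.
HB.instance Definition _ :=
  GRing.Zmodule.copy RmodZ (Quotient.quot int_subgroup).

Definition to_RmodZ (x : R) : RmodZ :=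
  (\pi_(Quotient.quot int_subgroup) x)%qT.

Definition of_RmodZ (x : RmodZ) : R :=
  repr (x : Quotient.quot int_subgroup).

(* The minimum of |x + k| over the integers k is written as an infimum; it is
   attained and does not depend on the representative of x: see
   circle_norm_attained and circle_norm_to_RmodZ. *)
Definition circle_norm (x : RmodZ) : R :=
  inf [set `|of_RmodZ x + k%:~R| | k in [set: int]].

Definition e_real (x : R) : R[i] :=
  Complex (cos (2 * pi * x)) (sin (2 * pi * x)).

(* Independent of the representative: see e_to_RmodZ. *)
Definition e (x : RmodZ) : R[i] := e_real (of_RmodZ x).

Definition well_spaced (delta : R) (B : {fset RmodZ}) : Prop :=
  forall x x', x \in B -> x' \in B -> x != x' ->
    delta <= circle_norm (x - x').

Definition norm1 (B : {fset RmodZ}) (f : B -> R[i]) : R :=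
  \sum_(b : B) Normc.normc (f b).

Definition norm2_sq (B : {fset RmodZ}) (f : B -> R[i]) : R :=
  \sum_(b : B) Normc.normc (f b) ^+ 2.

Lemma to_RmodZ_eqP (x y : R) :
  reflect (exists k : int, x - y = k%:~R) (to_RmodZ x == to_RmodZ y).
Proof. by rewrite /to_RmodZ -Quotient.idealrBE; exact: intrP. Qed.

Lemma of_RmodZK : cancel of_RmodZ to_RmodZ.
Proof. by move=> x; rewrite /to_RmodZ /of_RmodZ reprK. Qed.

Lemma of_to_RmodZ (x : R) : exists k : int, of_RmodZ (to_RmodZ x) = x + k%:~R.
Proof.
have /to_RmodZ_eqP[k xk] : to_RmodZ (of_RmodZ (to_RmodZ x)) == to_RmodZ x.
  by rewrite of_RmodZK.
by exists k; rewrite -xk addrC subrK.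
Qed.

Lemma to_RmodZB : {morph to_RmodZ : x y / x - y}.
Proof. exact: (raddfB (\pi_(Quotient.quot int_subgroup))%qT). Qed.

Lemma to_RmodZMn (n : nat) : {morph to_RmodZ : x / x *+ n}.
Proof. by move=> x; exact: (raddfMn (\pi_(Quotient.quot int_subgroup))%qT). Qed.

Lemma e_realD1 (x : R) : e_real (x + 1) = e_real x.
Proof.
by rewrite /e_real mulrDr mulr1 [2 * pi]mulr_natl cosD2pi sinD2pi.
Qed.

Lemma e_realDint (x : R) (k : int) : e_real (x + k%:~R) = e_real x.
Proof.
elim: k x => [x|n IH x|n IH x]; first by rewrite addr0.
  by rewrite -addn1 PoszD intrD addrA e_realD1.
by rewrite -[in LHS]e_realD1 -[RHS]IH -addn1 PoszD opprD intrD addrA subrK.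
Qed.

Lemma e_to_RmodZ (x : R) : e (to_RmodZ x) = e_real x.
Proof. by rewrite /e; have [k ->] := of_to_RmodZ x; exact: e_realDint. Qed.

Lemma circle_norm_to_RmodZ (x : R) :
  circle_norm (to_RmodZ x) = inf [set `|x + k%:~R| | k in [set: int]].
Proof.
rewrite /circle_norm; have [j ->] := of_to_RmodZ x; congr inf.
apply/seteqP; split=> _ [k _ <-].
  by exists (j + k) => //; rewrite intrD addrA.
by exists (k - j) => //; congr `|_|; rewrite intrB; ring.
Qed.

Lemma circle_norm_attained (x : RmodZ) :
  (exists k : int, circle_norm x = `|of_RmodZ x + k%:~R|) /\
  (forall k : int, circle_norm x <= `|of_RmodZ x + k%:~R|).
Proof.
rewrite /circle_norm; set y := of_RmodZ x.
set A := [set _ | _ in _].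
have A0 : has_lbound A by exists 0 => _ [k _ <-]; exact: normr_ge0.
have infA k : inf A <= `|y + k%:~R| by apply: ge_inf => //; exists k.
split=> //; suff [k kmin] : exists k : int, forall j : int,
    `|y + k%:~R| <= `|y + j%:~R|.
  exists k; apply/eqP; rewrite eq_le infA /=; apply: lb_le_inf.
    by exists `|y + k%:~R|, k.
  by move=> _ [j _ <-].
have [y0 y1] : (Num.floor y)%:~R <= y /\ y < (Num.floor y)%:~R + 1.
  by rewrite -(intrD _ _ 1) floor_le_tmp floorD1_gt.
set m := Num.floor y in y0 y1.
have far (j : int) : `|y - m%:~R| <= `|y + j%:~R| \/
                     `|y - m%:~R - 1| <= `|y + j%:~R|.
  have [jm|jm] := leP (- m) j.
    have : (- m)%:~R <= j%:~R :> R by rewrite ler_int.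
    by rewrite intrN => ?; left; rewrite !ger0_norm; lra.
  have : (j + 1)%:~R <= (- m)%:~R :> R by rewrite ler_int lezD1.
  by rewrite intrD intrN => ?; right; rewrite !ler0_norm; lra.
have [le|lt] := leP `|y - m%:~R| `|y - m%:~R - 1|.
  exists (- m) => j; rewrite intrN.
  by case: (far j) => //; exact: le_trans.
exists (- m - 1) => j; rewrite intrB intrN addrA.
by case: (far j) => //; apply: le_trans; exact: ltW.
Qed.

End Circle.

Section Sieve.
Variables (R : realType) (P : set nat) (L : forall p : nat, {set 'Z_p}).

(* The values of L at indices outside P are irrelevant; for p in P, which is
   prime, 'Z_p is Z/pZ. *)
Definition sieve_data : Prop :=
  [/\ P !=set0, (forall p, P p -> prime p) &
      forall p, P p -> L p != finset.set0 /\ L p != [set: 'Z_p]%SET].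

Definition lambda (p : nat) : nat := #|L p|.

Definition V (y : R) : R :=
  \big[*%R/1]_(p \in [set p : nat | P p /\ p%:R < y])
    ((1 - (lambda p)%:R / p%:R)^-1 : R).

Definition squarefree (m : nat) : Prop :=
  forall d : nat, (d ^ 2 %| m)%N -> d = 1%N.

Definition h_prime (p : nat) : R :=
  if p \in P then (lambda p)%:R / (p%:R - (lambda p)%:R) else 0.

Definition h (m : nat) : R :=
  if `[< squarefree m >] then \prod_(p <- primes m) h_prime p else 0.

Definition G (y : R) : R :=
  \sum_(m \in [set m : nat | (0 < m)%N /\ m%:R <= y]) h m.

Definition sifted (N z : R) : set nat :=
  [set n : nat | [/\ (0 < n)%N, n%:R <= N &
    forall p : nat, P p -> p%:R < z -> (n%:R : 'Z_p) \notin L p]].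

Lemma squarefree_gt0 (m : nat) : squarefree m -> (0 < m)%N.
Proof. by case: m => // /(_ 0%N (dvdn0 _)). Qed.

Lemma squarefreeM (m n : nat) : coprime m n ->
  squarefree (m * n) <-> squarefree m /\ squarefree n.
Proof.
move=> mn; split=> [sq|[sqm sqn] d dmn].
  by split=> d dd; apply: sq; [exact: dvdn_mulr|exact: dvdn_mull].
have d0 : (0 < d)%N.
  case: d dmn => //; rewrite dvd0n muln_eq0 => /orP[] /eqP E.
    by move/squarefree_gt0: sqm; rewrite E.
  by move/squarefree_gt0: sqn; rewrite E.
apply/eqP; apply: contraT => d1.
have p_pr : prime (pdiv d) by rewrite pdiv_prime // ltn_neqAle eq_sym d1.
have pmn : (pdiv d ^ 2 %| m * n)%N.
  by apply: dvdn_trans dmn; rewrite dvdn_exp2r // pdiv_dvd.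
have [pm|pm] := boolP (pdiv d %| m)%N.
  have pn : coprime (pdiv d ^ 2) n.
    by rewrite coprimeXl //; exact: coprime_dvdl mn.
  by move: p_pr; rewrite (sqm (pdiv d)) // -(Gauss_dvdl _ pn).
have pm' : coprime (pdiv d ^ 2) m by rewrite coprimeXl // prime_coprime.
by move: p_pr; rewrite (sqn (pdiv d)) // -(Gauss_dvdr _ pm').
Qed.

Lemma squarefree_prime (p : nat) : prime p -> squarefree p.
Proof.
move=> p_pr d dp; have : (d %| p)%N.
  by apply: dvdn_trans dp; rewrite expnS dvdn_mulr.
move/primeP: (p_pr) => [_ pd] /pd /orP[/eqP//|/eqP dE].
move: dp; rewrite dE => /(dvdn_leq (prime_gt0 p_pr)).
by rewrite leqNgt expnS expn1 ltn_Pmull ?prime_gt0 ?prime_gt1.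
Qed.

Lemma h_squarefreeN (m : nat) : ~ squarefree m -> h m = 0.
Proof. by move=> sq; rewrite /h asboolF. Qed.

Lemma h1 : h 1 = 1.
Proof.
rewrite /h asboolT ?big_nil // => d.
by rewrite dvdn1 => /eqP; case: d => [|[|d]].
Qed.

Lemma h_at_prime (p : nat) : prime p -> h p = h_prime p.
Proof.
move=> p_pr; rewrite /h asboolT; last exact: squarefree_prime.
by rewrite primes_prime // big_seq1.
Qed.

Lemma hM (m n : nat) : coprime m n -> h (m * n) = h m * h n.
Proof.
move=> mn; rewrite /h.
have -> : `[< squarefree (m * n) >] = `[< squarefree m >] && `[< squarefree n >].
  by rewrite -asbool_and; apply: asbool_equiv_eq; exact: squarefreeM.
have [sqm|] := asboolP (squarefree m); last by rewrite mul0r.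
have [sqn|] := asboolP (squarefree n); last by rewrite mulr0.
have [m0 n0] := (squarefree_gt0 sqm, squarefree_gt0 sqn).
rewrite -big_cat; apply: perm_big; apply: uniq_perm.
- exact: primes_uniq.
- rewrite cat_uniq !primes_uniq andbT /= -coprime_has_primes //.
- by move=> p; rewrite primesM // mem_cat.
Qed.

End Sieve.

(* Main.v *)
Require Import Defs.
From mathcomp Require Import all_boot all_order all_algebra finmap complex.
From mathcomp Require Import all_classical all_reals all_analysis.
From mathcomp Require Import ring lra.

(** Why the inequality holds.  Put r = |f|_1^2 / |f|_2^2 >= 1 and let z0 be a
    large fixed power of 2 r.  Only the primes p of the sieve with
    z0 <= p < z are used to majorise the sifted set.  The primes below z0 are
    paid for at the end, through G(z) <= 2 V(z0) Gs, where Gs is the part of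
    G(z) carried by the integers whose prime factors all lie in [z0, z)
    (G_le_V_mass).  The hypothesis on V turns V(z0) into the factor
    log^kappa (2 r), because log z0 is a constant times log (2 r).

    For each such p, let g_p be the function of mean zero modulo p equal to
    h(p) off L_p and to -1 on L_p, and let A be the sum over m <= z, m
    squarefree and composed of these primes, of the products of the g_p, p | m.
    On the sifted set A = Gs, so (A / Gs)^2 is a majorant: it is Selberg's.
    As g_p^2 = h(p) + (h(p) - 1) g_p, the square A^2 is again a combination
    of products g_Q over sets Q of primes, with product at most z^2
    (square_expansion, weight_supp).  The empty set has coefficient exactly
    Gs, and the coefficient of Q is at most 4^|Q| Gs (square_weight_le).

    Each g_p has Fourier coefficients at a / p, a <> 0, bounded by h(p), so g_Q
    is a combination of the characters of frequency k / q in lowest terms, q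
    the product of Q, with coefficients at most h(Q).  The fractions that
    occur are z^(-4)-spaced and z^4 <= N; hence summing the square of a
    Dirichlet kernel of length about 2 N over any translate of them costs
    O(N^2) (dirichlet_sum_spaced, sieve_freqs_sum).  Since every prime in use
    is at least z0 and lambda(p) is O(p^(1/4)), each 4 h(p) is at most 1 / r
    (h_prime_small), so all the nonempty Q together weigh at most Gs / r
    (weight_prod_le, selberg_fejer_sum_le).

    Now expand the sum of A^2 |F|^2, F being the trigonometric sum attached to
    f, against a triangular weight.  The empty Q gives Gs times the usual large
    sieve bound (N + 1 / delta) |f|_2^2, by Schur's test and the same spacing
    lemma.  The other Q, bounded uniformly in the frequency, give at most
    Gs (N / r) |f|_1^2 = Gs N |f|_2^2.  Dividing by Gs^2 leaves
    (N + 1 / delta) |f|_2^2 / Gs up to a constant (sifted_sum_le). *)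

Set Implicit Arguments.
Unset Strict Implicit.
Unset Printing Implicit Defensive.

Import Order.TTheory GRing.Theory Num.Theory.

Local Open Scope classical_set_scope.
Local Open Scope ring_scope.

(** * Sums and products compared along injections *)

Section Comparison.
Variable R : realDomainType.

Lemma ler_sum_inj (A : eqType) (B : finType) (s : seq A) (f : A -> B)
    (Q : pred B) (phi : B -> R) : uniq s -> {in s &, injective f} ->
  (forall a, a \in s -> Q (f a)) -> (forall b, Q b -> 0 <= phi b) ->
  \sum_(a <- s) phi (f a) <= \sum_(b | Q b) phi b.
Proof.
move=> us finj sQ phi0; rewrite -(big_map f predT phi).
rewrite big_uniq ?map_inj_in_uniq //= big_mkcond [leRHS]big_mkcond.
apply: ler_sum => b _; case: ifP => [/mapP[a /sQ Qfa ->]|_]; first by rewrite Qfa.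
by case: ifP => // /phi0.
Qed.

Lemma ler_sum_inj_nat (T : eqType) (s : seq T) (k : T -> nat) (phi : nat -> R)
    (c : R) : uniq s -> {in s &, injective k} -> (forall j, 0 <= phi j) ->
  (forall K, \sum_(j < K) phi j <= c) -> \sum_(x <- s) phi (k x) <= c.
Proof.
move=> us kinj phi0 hc.
rewrite -(big_map k predT phi); set t := map k s.
have ut : uniq t by rewrite map_inj_in_uniq.
pose K := (\max_(j <- t) j).+1.
have tK j : j \in t -> (j < K)%N by move=> jt; rewrite ltnS; exact: leq_bigmax_seq.
have /(perm_big _)-> : perm_eq t [seq j <- index_iota 0 K | j \in t].
  apply: uniq_perm => //; first by rewrite filter_uniq ?iota_uniq.
  move=> j; rewrite mem_filter mem_index_iota /=.
  by case: (boolP (j \in t)) => // /tK ->.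
rewrite big_filter; apply: le_trans (hc K).
rewrite -(big_mkord predT phi) big_mkcond; apply: ler_sum => j _.
by case: ifP.
Qed.

Lemma ler_prod_sub_seq (s1 s2 : seq nat) (F : nat -> R) : uniq s1 -> uniq s2 ->
  {subset s1 <= s2} -> (forall i, i \in s2 -> 1 <= F i) ->
  \prod_(i <- s1) F i <= \prod_(i <- s2) F i.
Proof.
move=> u1 u2 s12 F1.
rewrite [leRHS](bigID (fun i => i \in s1)) /= -!(big_filter s2).
have /(perm_big _)<- : perm_eq s1 [seq i <- s2 | i \in s1].
  apply: uniq_perm => //; first by rewrite filter_uniq.
  by move=> i; rewrite mem_filter; case: (boolP (i \in s1)) => // /s12 ->.
have p0 : 0 <= \prod_(i <- s1) F i.
  by rewrite big_seq; apply: prodr_ge0 => i /s12/F1; exact: le_trans.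
rewrite -[leLHS]mulr1 ler_wpM2l // big_seq.
elim/big_ind: _ => // [x y x1 y1|i]; first by rewrite -[1]mulr1 ler_pM.
by rewrite mem_filter => /andP[_ /F1].
Qed.

End Comparison.

(** * Additive characters of the circle and Dirichlet kernels *)

Section Character.
Import numFieldNormedType.Exports.
Variable R : realType.
Implicit Types (x y : RmodZ R) (z w : R[i]).
Local Notation normc := (@Normc.normc R).

Lemma normc_ge0 z : 0 <= normc z.
Proof. by case: z => a b; exact: sqrtr_ge0. Qed.

Lemma normc_sum (I : Type) (s : seq I) (Q : pred I) (F : I -> R[i]) :
  normc (\sum_(i <- s | Q i) F i) <= \sum_(i <- s | Q i) normc (F i).
Proof.
elim/big_ind2: _ => [|z1 a1 z2 a2 h1 h2|//]; first by rewrite Normc.normc0.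
by apply: (le_trans (le_normcD _ _)); exact: lerD.
Qed.

Lemma normcX z n : normc (z ^+ n) = normc z ^+ n.
Proof.
by elim: n => [|n IH]; rewrite ?expr0 ?Normc.normc1 // !exprS Normc.normcM IH.
Qed.

Lemma normc_real (a : R) : normc a%:C%C = `|a|.
Proof. by rewrite /Normc.normc /= expr0n /= addr0 sqrtr_sqr. Qed.

Lemma normc_conj z : normc (z^*)%C = normc z.
Proof. by case: z => a b /=; rewrite sqrrN. Qed.

Lemma sqr_normc_conj z : ((normc z ^+ 2)%:C)%C = z * (z^*)%C.
Proof.
case: z => a b; rewrite /Normc.normc sqr_sqrtr ?addr_ge0 ?sqr_ge0 //.
by apply/eqP; rewrite eq_complex /=; apply/andP; split; apply/eqP; ring.
Qed.

Lemma e_realD (a b : R) : e_real (a + b) = e_real a * e_real b.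
Proof.
rewrite /e_real mulrDr cosD sinD; apply/eqP; rewrite eq_complex /= eqxx /=.
by rewrite addrC [sin _ * cos _]mulrC [X in _ == X]addrC mulrC addrC.
Qed.

Lemma to_RmodZD (a b : R) : to_RmodZ (a + b) = to_RmodZ a + to_RmodZ b.
Proof. exact: (raddfD (\pi_(Quotient.quot (int_subgroup R)))%qT). Qed.

Lemma to_RmodZ0 : to_RmodZ (0 : R) = 0.
Proof. exact: (raddf0 (\pi_(Quotient.quot (int_subgroup R)))%qT). Qed.

Lemma eD x y : e (x + y) = e x * e y.
Proof.
by rewrite -[x]of_RmodZK -[y]of_RmodZK -to_RmodZD !e_to_RmodZ e_realD.
Qed.

Lemma e0 : e (0 : RmodZ R) = 1.
Proof.
by rewrite -to_RmodZ0 e_to_RmodZ /e_real mulr0 cos0 sin0.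
Qed.

Lemma eMn x n : e (x *+ n) = e x ^+ n.
Proof. by elim: n => [|n IH]; rewrite ?e0 // mulrS eD IH exprS. Qed.

Lemma normc_e x : normc (e x) = 1.
Proof. by rewrite /e /e_real /Normc.normc cos2Dsin2 sqrtr1. Qed.

Lemma eN x : e (- x) = ((e x)^*)%C.
Proof.
have h : e x * (e x)^*%C = 1 by rewrite -sqr_normc_conj normc_e expr1n.
by rewrite -[LHS]mulr1 -h mulrA -eD addNr e0 mul1r.
Qed.

Lemma circle_norm_rep x :
  exists y : R, [/\ to_RmodZ y = x, circle_norm x = `|y| & `|y| <= 2^-1].
Proof.
have [[k xk] xmin] := circle_norm_attained x.
exists (of_RmodZ x + k%:~R).
have [h1 h2] : `|of_RmodZ x + k%:~R| <= `|of_RmodZ x + (k + 1)%:~R| /\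
  `|of_RmodZ x + k%:~R| <= `|of_RmodZ x + (k - 1)%:~R|.
  by split; rewrite -xk.
split=> //; last first.
  move: h1 h2; rewrite intrD intrB !addrA -[1%:~R]/(1 : R).
  set y := _ + k%:~R => h1 h2.
  have sq (a b : R) : `|a| <= `|b| -> a ^+ 2 <= b ^+ 2.
    move=> ab; rewrite -(real_normK (num_real a)) -(real_normK (num_real b)).
    by rewrite ler_pXn2r ?nnegrE ?normr_ge0.
  have := sq _ _ h1; have := sq _ _ h2; rewrite ler_norml; clear => h1 h2.
  by apply/andP; split; nra.
rewrite -[X in _ = X](@of_RmodZK R x); apply/eqP/to_RmodZ_eqP; exists k.
by rewrite addrAC subrr add0r.
Qed.

Lemma circle_norm_le x (y : R) : to_RmodZ y = x -> circle_norm x <= `|y|.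
Proof.
move=> <-; have [_ h] := circle_norm_attained (to_RmodZ y).
have [k yk] := of_to_RmodZ y.
by apply: le_trans (h (- k)) _; rewrite yk intrN addrK.
Qed.

Lemma circle_norm_ge0 x : 0 <= circle_norm x.
Proof. by have [y [_ -> _]] := circle_norm_rep x. Qed.

(** A representative y of a nonzero q-torsion class is a nonzero integer divided
    by q. *)
Lemma circle_norm_torsion x (q : nat) : (0 < q)%N -> x *+ q = 0 -> x != 0 ->
  q%:R^-1 <= circle_norm x.
Proof.
move=> q0 xq x0; have [y [yx -> _]] := circle_norm_rep x.
have /to_RmodZ_eqP[j] : to_RmodZ (y *+ q) == to_RmodZ 0.
  by rewrite to_RmodZMn yx xq to_RmodZ0.
rewrite subr0 => yj.
have q0' : 0 < q%:R :> R by rewrite ltr0n.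
rewrite -[leLHS]mul1r ler_pdivrMr //.
rewrite -[q%:R](ger0_norm (ltW q0')) -normrM mulr_natr yj.
have j0 : j != 0.
  apply: contra x0 => /eqP j0; move: yj; rewrite j0 => /eqP.
  rewrite mulrn_eq0 -[q == 0%N]negbK -lt0n q0 /= => /eqP y0.
  by rewrite -yx y0 to_RmodZ0.
rewrite -intr_norm; have : 0 < `|j| by rewrite normr_gt0.
by rewrite gtz0_ge1 -(ler_int R).
Qed.

(** The mean value theorem gives v cos v <= sin v on [0, pi / 2].  Taking
    v = u / 2 and multiplying by cos v, the duplication formulas turn this into
    u (1 + cos u) / 4 <= sin u / 2, where cos u >= 0. *)
Lemma sin_ge_half (u : R) : 0 <= u <= pi / 2 -> u / 2 <= sin u.
Proof.
move=> /andP[u0 u1].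
have main (v : R) : 0 <= v <= pi / 2 -> v * cos v <= sin v.
  move=> /andP[v0 v1].
  have [c] : exists2 c, c \in `[0, v]%R & sin v - sin 0 = cos c * (v - 0).
    apply: MVT_segment => //.
    exact/continuous_subspaceT/continuous_sin.
  rewrite in_itv /= sin0 !subr0 => /andP[c0 cv] ->.
  rewrite mulrC ler_wpM2r //.
  case: (eqVneq c v) => [->//|cv'].
  have pi0 := pi_gt0 R.
  by rewrite ltW // ltr_cos ?in_itv /= ?lt_neqAle ?cv' ?cv //; apply/andP;
    split; lra.
have /main h : 0 <= u / 2 <= pi / 2 by apply/andP; split; lra.
have pi0 := pi_gt0 R.
have c0 : 0 <= cos (u / 2) by apply: cos_ge0_pihalf; apply/andP; split; lra.
have c1 : 0 <= cos u by apply: cos_ge0_pihalf; apply/andP; split; lra.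
have -> : u = (u / 2) *+ 2 by rewrite mulr2n; lra.
rewrite sin_mulr2n.
have := cos_mulr2n (u / 2).
rewrite -[(u / 2) *+ 2 in X in X -> _]mulr_natr divfK // => hc.
have h' := ler_wpM2l c0 h.
have uc := mulr_ge0 u0 c1.
have E : cos (u / 2) * (u / 2 * cos (u / 2)) = (u * cos u + u) / 4.
  by rewrite hc mulr2n; field.
move: h'; rewrite E; move: (cos (u / 2) * sin (u / 2)) => w h'.
by rewrite -[u / 2 *+ 2]mulr_natr -[w *+ 2]mulr_natr; lra.
Qed.

(** One has |e(y) - 1| = 2 sin (pi |y|) >= pi |y|, and pi >= 2. *)
Lemma normc_e_sub1 (y : R) : `|y| <= 2^-1 ->
  2 * `|y| <= normc (e (to_RmodZ y) - 1).
Proof.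
move=> y2; rewrite e_to_RmodZ /e_real /Normc.normc /= subr0.
have pi2 := pi_ge2 R.
have -> : (cos (2 * pi * y) - 1) ^+ 2 + sin (2 * pi * y) ^+ 2
   = (2 * sin (pi * `|y|)) ^+ 2.
  have -> : sin (2 * pi * y) ^+ 2 = 1 - cos (2 * pi * y) ^+ 2 by rewrite sin2cos2.
  have -> : cos (2 * pi * y) = cos ((pi * `|y|) *+ 2).
    rewrite -[RHS]cos_norm -[LHS]cos_norm; congr cos.
    by rewrite (_ : pi * `|y| *+ 2 = 2 * pi * `|y|) ?normrM ?normr_id // mulr2n; ring.
  rewrite cos_mulr2n exprMn sin2cos2; ring.
rewrite sqrtr_sqr; apply: le_trans (ler_norm _).
have h : 0 <= pi * `|y| <= pi / 2.
  by rewrite mulr_ge0 ?pi_ge0 //= ler_wpM2l ?pi_ge0.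
have := sin_ge_half h; have := normr_ge0 y; nra.
Qed.

Definition dirichlet (H : nat) x : R[i] := \sum_(j < H) e (x *+ j).

Lemma dirichlet_le H x : normc (dirichlet H x) <= H%:R.
Proof.
apply: le_trans (normc_sum _ _ _) _.
by rewrite (eq_bigr (fun=> 1)) ?sumr_const ?card_ord // => j _; rewrite normc_e.
Qed.

(** Geometric sum: (e(x) - 1) D(x) = e(H x) - 1 has modulus at most 2, whereas
    |e(x) - 1| is at least 2 ||x||. *)
Lemma dirichlet_circle_norm H x :
  normc (dirichlet H x) * circle_norm x <= 1.
Proof.
have [y [yx yn y2]] := circle_norm_rep x.
have h1 : normc (dirichlet H x) * normc (e x - 1) <= 2.
  rewrite -Normc.normcM mulrC /dirichlet.
  under eq_bigr => j _ do rewrite eMn.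
  rewrite -subrX1; apply: le_trans (le_normcD _ _) _.
  by rewrite normcN Normc.normc1 normcX normc_e expr1n.
have h2 := normc_e_sub1 y2; rewrite yx in h2; rewrite yn.
have := ler_wpM2l (normc_ge0 (dirichlet H x)) h2.
rewrite -[_ * `|y|]mul1r; lra.
Qed.

(** Adding |D| <= H and |D| ||x|| <= 1 gives |D| (1 / H + ||x||) <= 2.  This form
    covers small and large ||x|| at once and can be summed by telescoping. *)
Lemma dirichlet_bound H x : (0 < H)%N ->
  normc (dirichlet H x) ^+ 2 <= 4 / (H%:R^-1 + circle_norm x) ^+ 2.
Proof.
move=> H0; have H0' : 0 < H%:R :> R by rewrite ltr0n.
have c0 : 0 < H%:R^-1 + circle_norm x.
  by rewrite ltr_wpDr ?invr_gt0 ?circle_norm_ge0.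
rewrite ler_pdivlMr ?exprn_gt0 // -exprMn (_ : 4 = 2 ^+ 2); last by rewrite -natrX.
rewrite ler_pXn2r ?nnegrE //; last by rewrite mulr_ge0 ?normc_ge0 ?ltW.
rewrite mulrDr (_ : 2 = 1 + 1); last by [].
by rewrite lerD ?dirichlet_circle_norm // ler_pdivrMr ?mul1r ?dirichlet_le.
Qed.

End Character.

(** * Dirichlet kernels at well-spaced points *)

Section Spaced.
Variable R : realType.
Implicit Types (x y : RmodZ R).
Local Notation normc := (@Normc.normc R).

(** As eta <= c, the term with a = c + eta j is at most
    (2 / eta) (1 / a - 1 / (a + eta)), and these differences telescope. *)
Lemma sum_inv_sqr_le (eta c : R) (K : nat) : 0 < eta -> eta <= c ->
  \sum_(j < K) (c + eta * j%:R) ^- 2 <= 2 / (eta * c).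
Proof.
move=> eta0 etac; have c0 : 0 < c by exact: lt_le_trans etac.
have a0 (j : nat) : c <= c + eta * j%:R by rewrite lerDl mulr_ge0 ?(ltW eta0) ?ler0n.
suff h : \sum_(j < K) (c + eta * j%:R) ^- 2 <=
    2 / eta * (c^-1 - (c + eta * K%:R)^-1).
  apply: le_trans h _; rewrite invfM mulrA ler_wpM2l ?divr_ge0 ?(ltW eta0) //.
  by rewrite gerBl invr_ge0 (le_trans (ltW c0)).
elim: K => [|K IH]; first by rewrite big_ord0 mulr0 addr0 subrr mulr0.
rewrite big_ord_recr /=.
have -> : c + eta * K.+1%:R = c + eta * K%:R + eta.
  by rewrite -addn1 natrD mulrDr mulr1 addrA.
move: IH (a0 K); set S := \sum_(_ < _) _; set a := c + eta * K%:R => IH ca.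
have ap : 0 < a by exact: lt_le_trans ca.
suff h : a ^- 2 <= 2 / eta * (a^-1 - (a + eta)^-1).
  apply: le_trans (lerD IH h) _; rewrite -mulrDr.
  by rewrite addrA subrK.
have -> : 2 / eta * (a^-1 - (a + eta)^-1) = 2 / (a * (a + eta)).
  by field; rewrite !gt_eqF //= addr_gt0.
have b0 : 0 < a * (a + eta) by rewrite mulr_gt0 // addr_gt0.
rewrite (ler_pdivlMr _ _ b0) mulrC ler_pdivrMr ?exprn_gt0 //.
by rewrite expr2; nra.
Qed.

(** The analytic part of the large sieve.  Take representatives in
    [-1/2, 1/2].  Among those of one sign, the integer parts of |y| / eta' are
    distinct for any eta' <= eta, so the bound on the kernel is summed over
    distinct integers. *)
Lemma dirichlet_sum_spaced (s : seq (RmodZ R)) (eta : R) (H : nat) :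
  (0 < H)%N -> 0 < eta -> uniq s ->
  (forall x y, x \in s -> y \in s -> x != y -> eta <= circle_norm (x - y)) ->
  \sum_(x <- s) normc (dirichlet H x) ^+ 2 <= 16 * H%:R * (H%:R + eta^-1).
Proof.
move=> H0 eta0 us sp.
have H0' : 0 < H%:R :> R by rewrite ltr0n.
(* Lowering the spacing to at most 1 / H makes the telescoping sum apply. *)
pose eta' := Num.min eta H%:R^-1.
have eta'0 : 0 < eta' by rewrite lt_min eta0 invr_gt0.
have eta'H : eta' <= H%:R^-1 by rewrite ge_min lexx orbT.
have eta'V : eta'^-1 <= H%:R + eta^-1.
  rewrite /eta' /Num.min; case: ifP => _; first by rewrite lerDr ltW.
  by rewrite invrK lerDl invr_ge0 ltW.
pose rep x :=
  xget 0 [set y : R | [/\ to_RmodZ y = x, circle_norm x = `|y| & `|y| <= 2^-1]].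
have repP x : to_RmodZ (rep x) = x /\ circle_norm x = `|rep x|.
  rewrite /rep; case: xgetP => [y _ [] //|] h.
  by have [y hy] := circle_norm_rep x; case: (h y).
have main (sg : bool) : \sum_(x <- [seq x <- s | (0 <= rep x) == sg])
    normc (dirichlet H x) ^+ 2 <= 8 * H%:R * (H%:R + eta^-1).
  pose k x := Num.truncn (`|rep x| / eta').
  have kP x : eta' * (k x)%:R <= `|rep x| < eta' * (k x).+1%:R.
    have : 0 <= `|rep x| / eta' by rewrite divr_ge0 ?normr_ge0 ?(ltW eta'0).
    move/truncn_itv; rewrite -/(k x) ler_pdivlMr // ltr_pdivrMr //.
    by rewrite ![_%:R * _]mulrC.
  pose phi (j : nat) : R := 4 * (H%:R^-1 + eta' * j%:R) ^- 2.
  apply: (@le_trans _ _ (\sum_(x <- [seq x <- s | (0 <= rep x) == sg]) phi (k x))).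
    apply: ler_sum => x _; apply: le_trans (dirichlet_bound x H0) _.
    rewrite /phi ler_pM2l // lef_pV2 ?posrE ?exprn_gt0 //.
    - rewrite ler_pXn2r ?nnegrE ?addr_ge0 ?mulr_ge0 ?invr_ge0
        ?circle_norm_ge0 ?ler0n ?(ltW eta'0) //.
      by rewrite (repP x).2 lerD2l; case/andP: (kP x).
    - by rewrite ltr_wpDr ?circle_norm_ge0 ?invr_gt0.
    - by rewrite ltr_wpDr ?mulr_ge0 ?invr_gt0 ?(ltW eta'0) ?ler0n.
  apply: ler_sum_inj_nat; first by rewrite filter_uniq.
  - move=> x y; rewrite !mem_filter => /andP[/eqP sx xs] /andP[/eqP sy ys] kxy.
    apply/eqP; apply: contraT => xy.
    have := sp x y xs ys xy; rewrite leNgt => /negP[].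
    apply: (@le_lt_trans _ _ `|rep x - rep y|).
      by apply: circle_norm_le; rewrite to_RmodZB (repP x).1 (repP y).1.
    apply: (@lt_le_trans _ _ eta'); last by rewrite ge_min lexx.
    have := kP x; have := kP y; rewrite -kxy -addn1 natrD mulrDr mulr1.
    move: sx sy; case: sg => [sx sy|/negbT + /negbT].
      rewrite (ger0_norm sx) (ger0_norm sy) => /andP[a1 a2] /andP[a3 a4].
      by rewrite ltr_norml; apply/andP; split; lra.
    rewrite -!ltNge => sx sy.
    rewrite (ltr0_norm sx) (ltr0_norm sy) => /andP[a1 a2] /andP[a3 a4].
    by rewrite ltr_norml; apply/andP; split; lra.
  - move=> j; rewrite mulr_ge0 // invr_ge0 exprn_ge0 //.
    by rewrite addr_ge0 ?mulr_ge0 ?invr_ge0 ?ler0n ?(ltW eta'0).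
  - move=> K; rewrite -mulr_sumr.
    apply: (@le_trans _ _ (4 * (2 / (eta' * H%:R^-1)))).
      by rewrite ler_pM2l // sum_inv_sqr_le.
    rewrite invfM invrK; nra.
have -> : \sum_(x <- s) normc (dirichlet H x) ^+ 2 =
   \sum_(x <- [seq x <- s | (0 <= rep x) == true]) normc (dirichlet H x) ^+ 2
 + \sum_(x <- [seq x <- s | (0 <= rep x) == false]) normc (dirichlet H x) ^+ 2.
  rewrite !big_filter (bigID (fun x => 0 <= rep x)) /=; congr (_ + _).
    by apply: eq_bigl => x; rewrite eqb_id.
  by apply: eq_bigl => x; rewrite eqbF_neg.
by have := main true; have := main false; lra.
Qed.

End Spaced.

(** * Local detectors and their frequencies *)

Lemma coprime_prod_primes p (l : seq nat) : prime p -> all prime l ->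
  p \notin l -> coprime p (\prod_(q <- l) q).
Proof.
move=> pp al pl; rewrite prime_coprime // Euclid_dvd_prod // big_has -all_predC.
apply/allP => q ql /=; rewrite dvdn_prime2 ?(allP al _ ql) //.
by apply: contra pl => /eqP->.
Qed.

Section LocalFourier.
Variable R : realType.
Implicit Types (x y t : RmodZ R).
Local Notation normc := (@Normc.normc R).

Definition unit_frac (p : nat) : RmodZ R := to_RmodZ (p%:R^-1).

Lemma unit_fracMn_eq0 p k : (0 < p)%N -> (unit_frac p *+ k == 0) = (p %| k)%N.
Proof.
move=> p0; have p0' : p%:R != 0 :> R by rewrite pnatr_eq0 -lt0n.
rewrite /unit_frac -to_RmodZMn -to_RmodZ0; apply/to_RmodZ_eqP/idP.
  rewrite subr0 => -[j kj].
  have : k%:~R = (j * p%:Z)%:~R :> R.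
    rewrite intrM -kj -[_ *+ k]mulr_natr mulrAC -!pmulrn mulVf //.
    by rewrite mul1r.
  move/intr_inj => kjp.
  by have : (p%:Z %| k%:Z)%Z; [rewrite kjp dvdz_mull|].
case/dvdnP => q ->; exists q%:Z.
by rewrite subr0 -[_ *+ (q * p)]mulr_natr natrM mulrCA mulVf // mulr1.
Qed.

Lemma e_eq1 x : (e x == 1) = (x == 0).
Proof.
apply/idP/idP => [/eqP ex|/eqP->]; last by rewrite e0.
have [y [yx _ y2]] := circle_norm_rep x.
have := normc_e_sub1 y2; rewrite yx ex subrr Normc.normc0 => y0.
have /eqP : `|y| = 0 by have := normr_ge0 y; lra.
by rewrite normr_eq0 => /eqP y0'; rewrite -yx y0' to_RmodZ0.
Qed.

Lemma sum_e_unit_frac p k : (0 < p)%N ->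
  \sum_(a < p) e (unit_frac p *+ a *+ k) = (p * (p %| k))%N%:R :> R[i].
Proof.
move=> p0; under eq_bigr => a _ do rewrite mulrnAC eMn.
have [pk|pk] := boolP (p %| k)%N; last first.
  have e1 : e (unit_frac p *+ k) != 1 by rewrite e_eq1 unit_fracMn_eq0.
  apply: (mulfI (_ : e (unit_frac p *+ k) - 1 != 0)); first by rewrite subr_eq0.
  rewrite -subrX1 -eMn mulrnAC (eqP (_ : unit_frac p *+ p == 0)) ?unit_fracMn_eq0 //.
  by rewrite mul0rn e0 subrr muln0 mulr0.
under eq_bigr => a _.
  rewrite (eqP (_ : unit_frac p *+ k == 0)) ?unit_fracMn_eq0 // e0 expr1n.
over.
by rewrite sumr_const card_ord muln1.
Qed.

(** The value h(p), read off the set L_p alone. *)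
Definition local_density (p : nat) (Lp : {set 'Z_p}) : R :=
  #|Lp|%:R / (p%:R - #|Lp|%:R).

(** The shift s translates the sifted set, so that the triangular weights used
    later can be supported on natural numbers. *)
Definition local_detector (p : nat) (Lp : {set 'Z_p}) (s m : nat) : R :=
  if (m%:R - s%:R : 'Z_p) \in Lp then -1 else local_density Lp.

Lemma local_density_ge0 p (Lp : {set 'Z_p}) : (#|Lp| < p)%N ->
  0 <= local_density Lp.
Proof.
by move=> h; rewrite divr_ge0 ?ler0n // subr_ge0 ler_nat ltnW.
Qed.

(** Both sides are functions of a quantity with two values, h and -1, which are
    the roots of X^2 = h + (h - 1) X. *)
Lemma local_detector_sqr p (Lp : {set 'Z_p}) s m :
  local_detector Lp s m ^+ 2 =
  local_density Lp + (local_density Lp - 1) * local_detector Lp s m.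
Proof. by rewrite /local_detector; case: ifP => _; ring. Qed.

(** Orthogonality expands the indicator of each class of L_p over all
    frequencies a / p.  The frequency a = 0 disappears because the detector has mean
    zero; at a <> 0 the coefficient is -1 / (p - lambda) times a sum of lambda
    numbers of modulus 1. *)
Lemma local_detector_fourier p (Lp : {set 'Z_p}) s : prime p -> (#|Lp| < p)%N ->
  exists c : nat -> R[i],
    (forall a, normc (c a) <= local_density Lp) /\
    (forall m, (local_detector Lp s m)%:C%C =
       \sum_(1 <= a < p) c a * e (unit_frac p *+ a *+ m)).
Proof.
move=> pp lp; have p1 := prime_gt1 pp; have p0 := prime_gt0 pp.
have lp0 : 0 < p%:R - #|Lp|%:R :> R by rewrite subr_gt0 ltr_nat.
(* m - s lies in the class l exactly when p divides m + r l. *)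
pose r (l : 'Z_p) : nat := (- s%:R - l : 'Z_p).
pose S (a : nat) : R[i] := \sum_(l in Lp) e (unit_frac p *+ a *+ r l).
exists (fun a => - ((p%:R - #|Lp|%:R)^-1)%:C%C * S a); split => [a|m].
  rewrite Normc.normcM normcN normc_real ger0_norm ?invr_ge0 ?(ltW lp0) //.
  rewrite mulrC /local_density ler_pM2r ?invr_gt0 //.
  apply: le_trans (normc_sum _ _ _) _.
  by rewrite (eq_bigr (fun=> 1)) ?sumr_const // => l _; rewrite normc_e.
have dv (l : 'Z_p) : (m%:R - s%:R == l) = (p %| m + r l)%N.
  have -> : (m%:R - s%:R == l) = ((m + r l)%:R == 0 :> 'Z_p).
    by rewrite natrD natr_Zp addrA subr_eq0.
  by rewrite -val_eqE /= val_Zp_nat.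
have ind : \sum_(a < p) S a * e (unit_frac p *+ a *+ m) =
    (p * ((m%:R - s%:R)%R \in Lp))%N%:R.
  under eq_bigr => a _ do rewrite mulr_suml.
  rewrite exchange_big /=.
  under eq_bigr => l _.
    under eq_bigr => a _ do rewrite -eD -mulrnDr addnC.
    rewrite sum_e_unit_frac // -dv.
    over.
  have [hL|hL] := boolP (_ \in Lp).
    rewrite (bigD1 _ hL) /= eqxx big1 ?addr0 // => l /andP[_ /negbTE ll].
    by rewrite eq_sym ll muln0.
  rewrite muln0 big1 // => l lL.
  by case: eqP => [E|_]; [move: hL; rewrite E lL|rewrite muln0].
have S0 : S 0%N = #|Lp|%:R.
  by rewrite /S (eq_bigr (fun=> 1)) ?sumr_const // => l _; rewrite mulr0n mul0rn e0.
under eq_bigr => a _ do rewrite -mulrA.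
rewrite -mulr_sumr.
have -> : \sum_(1 <= a < p) S a * e (unit_frac p *+ a *+ m) =
   (p * ((m%:R - s%:R)%R \in Lp))%N%:R - #|Lp|%:R.
  rewrite -ind -(big_mkord predT (fun a => S a * e (unit_frac p *+ a *+ m))).
  by rewrite [in RHS]big_ltn // mulr0n mul0rn e0 S0 mulr1 addrAC subrr add0r.
have cn (n : nat) : n%:R = (n%:R : R)%:C%C :> R[i] by rewrite rmorph_nat.
rewrite !cn -rmorphB -rmorphN -rmorphM; congr (_%:C)%C.
rewrite /local_detector /local_density; case: ifP => _; rewrite ?muln1 ?muln0;
  by field; rewrite gt_eqF.
Qed.

(** The sums of a_p / p, p in the list, with every a_p nonzero modulo p: when the
    list consists of distinct primes with product q, these are the fractions
    k / q in lowest terms, modulo 1. *)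
Fixpoint freqs (l : seq nat) : seq (RmodZ R) :=
  if l is p :: l' then [seq unit_frac p *+ a + t | a <- index_iota 1 p, t <- freqs l']
  else [:: 0].

(** This is the sum of w(m) u(m) e(m x), where w(m) counts the pairs j, k < H
    with j + k = m.  The weight w is triangular, and its transform is the
    square of the Dirichlet kernel. *)
Definition fejer_sum (H : nat) (u : nat -> R[i]) x : R[i] :=
  \sum_(j < H) \sum_(k < H) u (j + k)%N * e (x *+ (j + k)).

Lemma fejer_sum1 H x : fejer_sum H (fun=> 1) x = dirichlet H x ^+ 2.
Proof.
rewrite expr2 /dirichlet mulr_suml; apply: eq_bigr => j _.
by rewrite mulr_sumr; apply: eq_bigr => k _; rewrite mul1r mulrnDr eD.
Qed.

Lemma fejer_sum_sum (I : finType) (C : pred I) (a : I -> R) (u : I -> nat -> R)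
    (y : RmodZ R) (H : nat) :
  fejer_sum H (fun m => (\sum_(i | C i) a i * u i m)%:C%C) y =
  \sum_(i | C i) (a i)%:C%C * fejer_sum H (fun m => (u i m)%:C%C) y.
Proof.
rewrite /fejer_sum; under [RHS]eq_bigr => i _ do rewrite mulr_sumr.
rewrite [RHS]exchange_big /=; apply: eq_bigr => j _.
under [RHS]eq_bigr => i _ do rewrite mulr_sumr.
rewrite [RHS]exchange_big /=; apply: eq_bigr => k _.
rewrite rmorph_sum /= mulr_suml; apply: eq_bigr => i _.
by rewrite rmorphM /= mulrA.
Qed.

(** A local expansion writes one factor g_p as a combination of characters, and
    a character only translates x.  Removing the primes one at a time leaves
    the kernel itself at all translates of x by a frequency of the list. *)
Lemma fejer_sum_freqs (H : nat) (g : nat -> nat -> R) (h : nat -> R) (l : seq nat) x :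
  (forall p, p \in l -> exists c : nat -> R[i],
    (forall a, normc (c a) <= h p) /\
    (forall m, (g p m)%:C%C = \sum_(1 <= a < p) c a * e (unit_frac p *+ a *+ m))) ->
  normc (fejer_sum H (fun m => (\prod_(p <- l) g p m)%:C%C) x) <=
  \prod_(p <- l) h p * \sum_(t <- freqs l) normc (dirichlet H (x + t)) ^+ 2.
Proof.
elim: l x => [|p l IH] x hl.
  rewrite big_nil mul1r /= big_seq1 addr0 -normcX -fejer_sum1.
  rewrite /fejer_sum.
  by under eq_bigr => j _ do under eq_bigr => k _ do rewrite big_nil.
have [c [cle cE]] := hl p (mem_head _ _).
have IH' y := IH y (fun q ql => hl q (mem_behead (s := p :: l) ql)).
set u := fun m => (\prod_(q <- l) g q m)%:C%C in IH'.
have -> : fejer_sum H (fun m => (\prod_(q <- p :: l) g q m)%:C%C) x =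
    \sum_(1 <= a < p) c a * fejer_sum H u (x + unit_frac p *+ a).
  rewrite /fejer_sum; under [RHS]eq_bigr => a _ do rewrite mulr_sumr.
  rewrite [RHS]exchange_big /=; apply: eq_bigr => j _.
  under [RHS]eq_bigr => a _ do rewrite mulr_sumr.
  rewrite [RHS]exchange_big /=; apply: eq_bigr => k _.
  rewrite big_cons rmorphM /= cE !mulr_suml; apply: eq_bigr => a _.
  by rewrite mulrnDl eD /u; ring.
apply: le_trans (normc_sum _ _ _) _.
rewrite big_cons /= big_allpairs_dep /= -mulrA mulr_sumr mulr_sumr.
apply: ler_sum => a _; rewrite Normc.normcM.
apply: ler_pM (normc_ge0 _) (normc_ge0 _) (cle a) _.
have -> : \sum_(t <- freqs l) normc (dirichlet H (x + (unit_frac p *+ a + t))) ^+ 2 =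
    \sum_(t <- freqs l) normc (dirichlet H (x + unit_frac p *+ a + t)) ^+ 2.
  by apply: eq_bigr => t _; rewrite addrA.
exact: IH'.
Qed.

(** Let q be the product of the tail.  Multiplying t n = 0 by q kills the tail
    component and shows p | n; multiplying it by p kills a / p and shows q | n
    by induction.  This exact order tells fractions with different denominators
    apart. *)
Lemma freqs_order (l : seq nat) t n : all prime l -> uniq l -> t \in freqs l ->
  (t *+ n == 0) = (\prod_(p <- l) p %| n)%N.
Proof.
elim: l t n => [|p l IH] t n /=.
  by move=> _ _; rewrite inE => /eqP->; rewrite mul0rn eqxx big_nil dvd1n.
move=> /andP[pp al] /andP[pl ul] /allpairsPdep[a [t' [ai tl ->]]].
have p0 := prime_gt0 pp.
have cop := coprime_prod_primes pp al pl.
rewrite big_cons Gauss_dvd //; apply/eqP/andP => [h|[/dvdnP[k ->] ln]].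
- have t'q : t' *+ \prod_(q <- l) q = 0 by apply/eqP; rewrite IH.
  split.
    have : unit_frac p *+ (a * n * \prod_(q <- l) q) == 0.
      move/(congr1 (fun z => z *+ \prod_(q <- l) q)): h.
      by rewrite !mulrnDl mul0rn [t' *+ n *+ _]mulrnAC t'q mul0rn addr0 !mulrnA => ->.
    rewrite unit_fracMn_eq0 // Gauss_dvdl // Euclid_dvdM // => /orP[|//].
    by move: ai; rewrite mem_index_iota => /andP[a0 ap] /(dvdn_leq a0);
      rewrite leqNgt ap.
  have : t' *+ (n * p) == 0.
    move/(congr1 (fun z => z *+ p)): h; rewrite !mulrnDl mul0rn.
    have -> : unit_frac p *+ a *+ n *+ p = 0.
      by rewrite -!mulrnA; apply/eqP; rewrite unit_fracMn_eq0 // !dvdn_mull.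
    by rewrite add0r mulrnA => ->.
  by rewrite IH // Gauss_dvdl // coprime_sym.
- rewrite mulrnDl; have /eqP-> : t' *+ (k * p) == 0 by rewrite IH.
  by rewrite addr0 -mulrnA; apply/eqP; rewrite unit_fracMn_eq0 // mulnA dvdn_mull.
Qed.

(** If a / p + r = b / p + r', multiplication by the product of the tail leaves
    (a - b) / p times an integer prime to p, so a = b. *)
Lemma freqs_uniq (l : seq nat) : all prime l -> uniq l -> uniq (freqs l).
Proof.
elim: l => [|p l IH] //= /andP[pp al] /andP[pl ul].
apply: allpairs_uniq; rewrite ?iota_uniq ?IH //.
move=> [a t] [a' t'] /allpairsPdep[b [r [bi ri [-> ->]]]].
move=> /allpairsPdep[b' [r' [bi' ri' [-> ->]]]] /=.
have p0 := prime_gt0 pp.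
have cop := coprime_prod_primes pp al pl.
wlog bb : b b' r r' bi bi' ri ri' / (b <= b')%N.
  move=> W h; have [|/ltnW] := leqP b b'; first by move=> /W; apply.
  by move=> /(W b' b r' r bi' bi ri' ri); rewrite h => /(_ erefl) ->.
move=> E; have := congr1 (fun z => z *+ \prod_(q <- l) q) E.
rewrite !mulrnDl.
have -> : r *+ \prod_(q <- l) q = 0 by apply/eqP; rewrite (@freqs_order l).
have -> : r' *+ \prod_(q <- l) q = 0 by apply/eqP; rewrite (@freqs_order l).
rewrite !addr0 -!mulrnA => /esym/eqP.
rewrite -subr_eq0 -mulrnBr ?leq_mul2r ?bb ?orbT //.
rewrite unit_fracMn_eq0 // -mulnBl Gauss_dvdl // => pb.
have b'b : b' = b.
  apply/eqP; rewrite eqn_leq bb andbT; apply: contraLR pb; rewrite -ltnNge => bb'.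
  rewrite gtnNdvd ?subn_gt0 //; apply: leq_ltn_trans (leq_subr _ _) _.
  by move: bi'; rewrite mem_index_iota => /andP[].
by move: E; rewrite b'b => /addrI->.
Qed.

End LocalFourier.

(** * The square of a Selberg sum *)

Section SelbergSquare.
Variables (R : realDomainType) (I : finType).
Implicit Types (J Q D : {set I}).

(** J is recovered from D and its trace on Q. *)
Lemma card_setD_fiber Q D : (#|[set J | J :\: Q == D]%SET| <= 2 ^ #|Q|)%N.
Proof.
rewrite -card_powerset.
rewrite -(@card_in_imset _ _ (fun J => J :&: Q)%SET); last first.
  move=> J J'; rewrite !inE => /eqP h /eqP h' h''.
  by rewrite -(setID J Q) -(setID J' Q) h h' h''.
apply: subset_leq_card; apply/fintype.subsetP => _ /imsetP[J _ ->].
by rewrite powersetE subsetIr.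
Qed.

Variables (univ : {set I}) (adm : pred {set I}) (h : I -> R).
Hypothesis adm_univ : forall J, adm J -> J \subset univ.
Hypothesis adm_sub : forall J D, adm J -> D \subset J -> adm D.

(** In (product of g over J) (product of g over J'), each g_i^2 with i in both
    sets is replaced by h_i + (h_i - 1) g_i.  This is the coefficient, once the
    result is multiplied out, of the product of g over Q. *)
Definition pair_weight J J' Q : R :=
  \prod_i (if i \in Q
           then if i \in J then if i \in J' then h i - 1 else 1
                else (i \in J')%:R
           else if i \in J then if i \in J' then h i else 0
                else (i \notin J')%:R).

Definition square_weight Q : R :=
  \sum_(J | adm J) \sum_(J' | adm J') pair_weight J J' Q.

(** Both the value of the Selberg sum on sifted integers and the constant term
    of its square. *)
Definition adm_mass : R := \sum_(J | adm J) \prod_(i in J) h i.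

Lemma square_expansion (g : I -> R) :
  (forall i, g i ^+ 2 = h i + (h i - 1) * g i) ->
  (\sum_(J | adm J) \prod_(i in J) g i) ^+ 2 =
  \sum_Q square_weight Q * \prod_(i in Q) g i.
Proof.
move=> gsq; rewrite expr2 mulr_suml.
under [RHS]eq_bigr => Q _ do rewrite mulr_suml.
rewrite [RHS]exchange_big /=; apply: eq_bigr => J _.
under [RHS]eq_bigr => Q _ do rewrite mulr_suml.
rewrite mulr_sumr [RHS]exchange_big /=; apply: eq_bigr => J' _.
rewrite !(big_mkcond (fun i => i \in _)) -big_split /=.
(* F i and G i are the coefficients of g i and of 1 in the i-th factor. *)
pose F i : R := if i \in J then if i \in J' then h i - 1 else 1 else (i \in J')%:R.
pose G i : R := if i \in J then if i \in J' then h i else 0 else (i \notin J')%:R.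
transitivity (\prod_i (F i * g i + G i)).
  apply: eq_bigr => i _; rewrite /F /G.
  case: (i \in J); case: (i \in J') => /=; rewrite ?mul1r ?mulr1 ?addr0 ?mul0r ?add0r //.
  by rewrite -expr2 gsq addrC.
rewrite bigA_distr; apply: eq_bigr => Q _.
rewrite [X in _ * X]big_mkcond -big_split /=; apply: eq_bigr => i _.
by rewrite /F /G; case: (i \in Q); rewrite ?mulr1.
Qed.

Lemma square_weight_supp Q : square_weight Q != 0 ->
  exists J J', [/\ adm J, adm J' & Q \subset J :|: J'].
Proof.
apply: contraNP => hn; rewrite /square_weight big1 // => J aJ.
rewrite big1 // => J' aJ'; apply/eqP; rewrite prodf_seq_eq0.
case: (boolP (Q \subset J :|: J')) => [s|]; first by case: hn; exists J, J'.
case/fintype.subsetPn => i iQ; rewrite inE negb_or => /andP[/negbTE iJ /negbTE iJ'].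
by apply/hasP; exists i; rewrite ?mem_index_enum //= iQ iJ iJ'.
Qed.

(** The constant term vanishes unless J = J', because a function g_i left alone
    contributes no constant. *)
Lemma square_weight0 : square_weight finset.set0 = adm_mass.
Proof.
apply: eq_bigr => J aJ; rewrite (bigD1 J) //= big1 ?addr0 => [|J' /andP[_ JJ']].
  rewrite [RHS]big_mkcond; apply: eq_bigr => i _.
  by rewrite inE; case: ifP => //= ->.
apply/eqP; rewrite prodf_seq_eq0.
have [k] : exists i, (i \in J') != (i \in J).
  apply/existsP; apply: contraNT JJ'; rewrite negb_exists => /forallP E.
  by apply/eqP/setP => i; have := E i; rewrite negbK => /eqP.
move=> ij; apply/hasP; exists k; rewrite ?mem_index_enum //= inE.
by move: ij; case: (k \in J); case: (k \in J').
Qed.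

Hypothesis h01 : forall i, i \in univ -> 0 <= h i <= 1.

Lemma adm_prod_ge0 J : adm J -> 0 <= \prod_(i in J) h i.
Proof.
move=> aJ; apply: prodr_ge0 => i iJ.
by case/andP: (h01 (fintype.subsetP (adm_univ aJ) _ iJ)).
Qed.

Lemma adm_mass_ge1 : adm finset.set0 -> 1 <= adm_mass.
Proof.
move=> a0; rewrite /adm_mass (bigD1 _ a0) /= big_set0 lerDl.
by apply: sumr_ge0 => J /andP[aJ _]; exact: adm_prod_ge0.
Qed.

(** Off Q only constants may be chosen, which forces J and J' to agree there;
    on Q every factor 0, 1 or h_i - 1 has modulus at most 1. *)
Lemma pair_weight_le J J' Q : adm J -> adm J' ->
  `|pair_weight J J' Q| <=
  if J :\: Q == J' :\: Q then \prod_(i in J :\: Q) h i else 0.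
Proof.
move=> aJ aJ'; rewrite /pair_weight big_if /= normrM -[leRHS]mul1r.
have hJ i : i \in J -> 0 <= h i <= 1 by move/(fintype.subsetP (adm_univ aJ))/h01.
apply: ler_pM => //.
  rewrite normr_prod; apply: prodr_ile1 => i _; rewrite normr_ge0 /=.
  case: (boolP (i \in J)) => [/hJ/andP[h0 h1]|_]; case: (i \in J') => /=;
    rewrite ?normr1 ?normr0 //.
  by rewrite ler_norml; apply/andP; split; lra.
case: ifP => [/eqP E|].
  rewrite ger0_norm.
    rewrite [leRHS]big_mkcond [leLHS]big_mkcond /=.
    rewrite (eq_bigr (fun i => if i \in J :\: Q then h i else 1)) // => i _.
    have := congr1 (fun X : {set I} => i \in X) E; rewrite !inE.
    by case: (i \in Q) => //=; case: (i \in J); case: (i \in J').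
  apply: prodr_ge0 => i _; case: (boolP (i \in J)) => [/hJ/andP[h0 _]|_] //.
  by case: ifP.
move/negbT => E; rewrite normr_le0 prodf_seq_eq0.
have [k] : exists i, (i \in J :\: Q) != (i \in J' :\: Q).
  apply/existsP; apply: contraNT E; rewrite negb_exists => /forallP E.
  by apply/eqP/setP => i; have := E i; rewrite negbK => /eqP.
move=> ij; apply/hasP; exists k; rewrite ?mem_index_enum //=.
by move: ij; rewrite !inE; case: (k \in Q); case: (k \in J); case: (k \in J') => //=.
Qed.

(** Given the common part D of J and J' off Q, there are at most 2^|Q| choices for
    each of J and J', and D is itself admissible. *)
Lemma square_weight_le Q : `|square_weight Q| <= 4 ^+ #|Q| * adm_mass.
Proof.
pose u D : R := \prod_(i in D) h i.
have u0 J : adm J -> 0 <= u (J :\: Q).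
  by move=> aJ; apply: adm_prod_ge0; apply: adm_sub aJ _; exact: subsetDl.
have fib D : (#|[set J | J :\: Q == D]%SET|)%:R <= 2 ^+ #|Q| :> R.
  by rewrite -natrX ler_nat card_setD_fiber.
apply: (@le_trans _ _ (\sum_(J | adm J) 2 ^+ #|Q| * u (J :\: Q))).
  apply: le_trans (ler_norm_sum _ _ _) _; apply: ler_sum => J aJ.
  apply: le_trans (ler_norm_sum _ _ _) _.
  apply: (@le_trans _ _ (\sum_(J' in [set J' | J' :\: Q == J :\: Q]%SET) u (J :\: Q))).
    rewrite big_mkcond [leRHS]big_mkcond; apply: ler_sum => J' _.
    rewrite inE; case: ifP => aJ'; last by case: ifP; rewrite ?u0.
    by rewrite eq_sym; exact: pair_weight_le.
  by rewrite sumr_const -[_ *+ _]mulr_natl ler_wpM2r ?u0.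
rewrite -mulr_sumr (_ : 4 ^+ #|Q| = 2 ^+ #|Q| * 2 ^+ #|Q| :> R); last first.
  by rewrite -exprMn -natrM.
rewrite -mulrA ler_wpM2l ?exprn_ge0 //.
rewrite (partition_big (fun J => J :\: Q) adm) /=; last first.
  by move=> J aJ; apply: adm_sub aJ _; exact: subsetDl.
rewrite /adm_mass mulr_sumr; apply: ler_sum => D aD.
apply: (@le_trans _ _ (\sum_(J in [set J | J :\: Q == D]%SET) u D)).
  rewrite big_mkcond [leRHS]big_mkcond; apply: ler_sum => J _.
  rewrite inE; case: (adm J) => /=; first by case: eqP => // ->.
  by case: ifP => // _; exact: adm_prod_ge0.
by rewrite sumr_const -[_ *+ _]mulr_natl ler_wpM2r //; exact: adm_prod_ge0.
Qed.

End SelbergSquare.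

(** * Splitting the sieve density at z0 *)

Section SieveMass.
Variables (R : realType) (P : set nat) (L : forall p : nat, {set 'Z_p}).
Hypothesis sd : sieve_data P L.
Local Notation hp := (h_prime R P L).

Lemma sieve_prime p : P p -> prime p.
Proof. by case: sd => _ h _; exact: h. Qed.

Lemma lambda_lt p : P p -> (#|L p| < p)%N.
Proof.
move=> Pp; have p1 := prime_gt1 (sieve_prime Pp).
case: sd => _ _ /(_ p Pp) [_ LT].
have : (#|L p| < #|[set: 'Z_p]%SET|)%N by rewrite proper_card // properT.
by rewrite cardsT card_ord => h; apply: leq_trans h _; rewrite Zp_cast.
Qed.

Lemma h_primeE p : P p -> hp p = local_density R (L p).
Proof. by move=> Pp; rewrite /h_prime mem_set. Qed.

Lemma h_prime_ge0 p : 0 <= hp p.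
Proof.
rewrite /h_prime; case: ifP => // /set_mem Pp.
exact: (local_density_ge0 R (lambda_lt Pp)).
Qed.

Lemma V_factorE p : P p -> (1 - (lambda L p)%:R / p%:R)^-1 = 1 + hp p.
Proof.
move=> Pp; rewrite h_primeE // /local_density /lambda.
have p0 : p%:R != 0 :> R by rewrite pnatr_eq0 -lt0n prime_gt0 // sieve_prime.
have d0 : p%:R - #|L p|%:R != 0 :> R.
  by rewrite gt_eqF // subr_gt0 ltr_nat lambda_lt.
by field; rewrite p0 d0.
Qed.

(** Together with big_prime_divisors, this identifies a squarefree integer with its
    set of prime factors. *)
Lemma primes_prod_squarefree m : squarefree m -> (\prod_(p <- primes m) p)%N = m.
Proof.
move=> sm; have m0 := squarefree_gt0 sm.
rewrite [RHS](prod_prime_decomp m0) prime_decompE big_map /=.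
apply: eq_big_seq => p pm; have := pm; rewrite mem_primes => /and3P[pp _ pdm].
have l1 : (0 < logn p m)%N by rewrite logn_gt0.
have : (logn p m <= 1)%N.
  rewrite leqNgt; apply/negP => l2.
  have : (p ^ 2 %| m)%N by rewrite pfactor_dvdn.
  by move/sm => p1; move: pp; rewrite p1.
by case: (logn p m) l1 => [|[|?]] //; rewrite expn1.
Qed.

Section Level.
Variables (z z0 : R).
Hypothesis z1 : 1 <= z.

Local Notation n0 := (Num.truncn z).+1.

Lemma ltn_level i : (i < n0)%N = (i%:R <= z).
Proof. by rewrite ltnS truncn_ge_nat // (le_trans _ z1). Qed.

Definition prime_divisors (m : nat) : {set 'I_n0} :=
  [set i : 'I_n0 | val i \in primes m]%SET.

Lemma big_prime_divisors (S : Type) (idx : S) (op : Monoid.com_law idx)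
    (F : nat -> S) m : (m < n0)%N ->
  \big[op/idx]_(i in prime_divisors m) F i = \big[op/idx]_(p <- primes m) F p.
Proof.
move=> mn.
have /(perm_big _)-> : perm_eq (primes m) [seq p <- index_iota 0 n0 | p \in primes m].
  apply: uniq_perm; rewrite ?primes_uniq ?filter_uniq ?iota_uniq //.
  move=> p; rewrite mem_filter mem_index_iota /=.
  case: (boolP (p \in primes m)) => //=; rewrite mem_primes => /and3P[_ m0 pm].
  by rewrite (leq_ltn_trans (dvdn_leq m0 pm)).
rewrite big_filter big_mkord; apply: eq_bigl => i.
by rewrite inE.
Qed.

Definition sieve_primes : {set 'I_n0} := [set i : 'I_n0 | val i \in P]%SET.

Definition sift_univ : {set 'I_n0} :=
  [set i : 'I_n0 | [&& val i \in P, z0 <= (val i)%:R & (val i)%:R < z]]%SET.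

Definition set_prod (J : {set 'I_n0}) : nat := (\prod_(i in J) val i)%N.

Definition sift_adm : pred {set 'I_n0} :=
  fun J => (J \subset sift_univ) && ((set_prod J)%:R <= z).

(** The part of G(z) carried by the integers with all prime factors in
    [z0, z). *)
Definition sift_mass : R := adm_mass sift_adm (fun i => hp (val i)).

Lemma set_prod_sub (J D : {set 'I_n0}) : J \subset sieve_primes -> D \subset J ->
  (set_prod D <= set_prod J)%N.
Proof.
move=> JP DJ; rewrite /set_prod [X in (_ <= X)%N](big_setID D) /=.
move/finset.setIidPr: DJ => ->; rewrite leq_pmulr // prodn_cond_gt0 // => i.
rewrite inE => /andP[_] /(fintype.subsetP JP); rewrite inE => /set_mem Pi.
exact/prime_gt0/sieve_prime.
Qed.

Lemma sift_univ_sub : sift_univ \subset sieve_primes.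
Proof. by apply/fintype.subsetP => i; rewrite !finset.in_set => /and3P[]. Qed.

Lemma sift_adm_univ J : sift_adm J -> J \subset sift_univ.
Proof. by case/andP. Qed.

Lemma sift_adm_sub (J D : {set 'I_n0}) : sift_adm J -> D \subset J -> sift_adm D.
Proof.
case/andP => Ju Jz DJ; rewrite /sift_adm (fintype.subset_trans DJ Ju) /=.
apply: le_trans Jz; rewrite ler_nat set_prod_sub //.
exact: fintype.subset_trans Ju sift_univ_sub.
Qed.

Lemma sift_adm0 : sift_adm finset.set0.
Proof. by rewrite /sift_adm finset.sub0set /set_prod big_set0 z1. Qed.

(** An integer m <= z with h(m) nonzero is the product of a set of sieving
    primes, and h(m) is the product of h over that set. *)
Lemma G_le_sum_sets : G P L z <=
  \sum_(J : {set 'I_n0} | (J \subset sieve_primes) && ((set_prod J)%:R <= z))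
    \prod_(i in J) hp (val i).
Proof.
set D := [set m : nat | (0 < m)%N /\ m%:R <= z].
have finD : finite_set D.
  apply: sub_finite_set (finite_II n0) => m [_ mz] /=.
  by rewrite ltn_level.
rewrite /G fsbig_finite //.
have inD m : m \in fset_set D -> (0 < m)%N /\ (m < n0)%N.
  by rewrite in_fset_set // => /set_mem [m0 mz]; rewrite ltn_level.
have -> : \sum_(m <- fset_set D) h R P L m =
   \sum_(m <- [seq m <- fset_set D | h R P L m != 0])
     \prod_(i in prime_divisors m) hp (val i).
  rewrite big_filter [RHS]big_mkcond /= big_seq [RHS]big_seq; apply: eq_bigr => m mD.
  case: eqP => [->//|/= hm]; rewrite (big_prime_divisors _ hp) ?(inD m mD).2 //.
  by move: hm; rewrite /h; case: asboolP.
have sq m : h R P L m != 0 -> squarefree m.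
  by rewrite /h; case: asboolP => //; rewrite eqxx.
apply: ler_sum_inj.
- by rewrite filter_uniq ?fset_uniq.
- move=> m m'; rewrite !mem_filter => /andP[hm mD] /andP[hm' mD'] E.
  rewrite -(primes_prod_squarefree (sq m hm)) -(primes_prod_squarefree (sq m' hm')).
  rewrite -(big_prime_divisors _ id) ?(inD m mD).2 //.
  by rewrite -(big_prime_divisors _ id) ?(inD m' mD').2 // E.
- move=> m; rewrite mem_filter => /andP[hm mD]; apply/andP; split.
    apply/fintype.subsetP => i; rewrite !finset.in_set => im.
    apply: contraNT (hm) => iP; rewrite /h asboolT; last exact: sq.
    rewrite prodf_seq_eq0; apply/hasP; exists (val i) => //=.
    by rewrite /h_prime (negbTE iP).
  rewrite /set_prod (big_prime_divisors _ id) ?(inD m mD).2 //.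
  rewrite primes_prod_squarefree; last exact: sq.
  by rewrite -ltn_level; exact: (inD m mD).2.
- by move=> J _; apply: prodr_ge0 => i _; exact: h_prime_ge0.
Qed.

(** Cut each set of primes into its part in [z0, z), still admissible, and the
    rest; on the rest the size condition is dropped, and the sum factors. *)
Lemma sum_sets_le :
  \sum_(J : {set 'I_n0} | (J \subset sieve_primes) && ((set_prod J)%:R <= z))
    \prod_(i in J) hp (val i) <=
  sift_mass * \prod_(i in sieve_primes :\: sift_univ) (1 + hp (val i)).
Proof.
pose u (J : {set 'I_n0}) : R := \prod_(i in J) hp (val i).
have u0 J : 0 <= u J by apply: prodr_ge0 => i _; exact: h_prime_ge0.
set Rs := sieve_primes :\: sift_univ.
have -> : \prod_(i in Rs) (1 + hp (val i)) = \sum_(X : {set 'I_n0} | X \subset Rs) u X.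
  rewrite big_mkcond /=.
  transitivity (\prod_(i < n0) ((if i \in Rs then hp (val i) else 0) + 1)).
    by apply: eq_bigr => i _; case: ifP; rewrite ?add0r // addrC.
  rewrite bigA_distr [RHS]big_mkcond; apply: eq_bigr => X _.
  rewrite big_if /= [X in _ * X]big1 // mulr1.
  case: (boolP (X \subset Rs)) => [XR|/fintype.subsetPn[k kX kR]].
    by apply: eq_bigr => i /(fintype.subsetP XR) ->.
  by rewrite (bigD1 k) //= (negbTE kR) mul0r.
rewrite /sift_mass /adm_mass mulr_suml.
under [leRHS]eq_bigr => D _ do rewrite mulr_sumr.
rewrite pair_big /=.
pose f (J : {set 'I_n0}) := (J :&: sift_univ, J :\: sift_univ).
rewrite -[leLHS]big_enum.
have -> : \sum_(J <- enum (fun J : {set 'I_n0} =>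
      (J \subset sieve_primes) && ((set_prod J)%:R <= z))) u J =
   \sum_(J <- enum (fun J : {set 'I_n0} =>
      (J \subset sieve_primes) && ((set_prod J)%:R <= z))) u (f J).1 * u (f J).2.
  by apply: eq_bigr => J _; rewrite /u /f /= -big_setID.
apply: (@ler_sum_inj _ _ _ _ f _ (fun X => u X.1 * u X.2)).
- exact: enum_uniq.
- move=> J J' _ _ [E1 E2].
  by rewrite -(setID J sift_univ) -(setID J' sift_univ) E1 E2.
- move=> J; rewrite mem_enum => /andP[JP Jz] /=; rewrite finset.setSD // andbT.
  rewrite /sift_adm subsetIr /=; apply: le_trans Jz; rewrite ler_nat.
  by rewrite set_prod_sub // subsetIl.
- by move=> X _; rewrite mulr_ge0.
Qed.

(** The remaining primes p <= z are those below z0, whose product is at most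
    V(z0), and possibly p = z >= z0: the sum G(z) allows m = z while the sieve
    only uses p < z.  That one prime contributes a factor 1 + h(p) <= 2. *)
Lemma prod_complement_le : 2 <= z0 -> (forall p, P p -> z0 <= p%:R -> hp p <= 1) ->
  \prod_(i in sieve_primes :\: sift_univ) (1 + hp (val i)) <= 2 * V P L z0.
Proof.
move=> z02 hp1; have z00 : 0 <= z0 by apply: le_trans z02.
have F1 p : 1 <= 1 + hp p by rewrite lerDl h_prime_ge0.
rewrite (bigID (fun i : 'I_n0 => (val i)%:R < z0)) /= mulrC.
have pge0 (Q : pred 'I_n0) : 0 <= \prod_(i < n0 | Q i) (1 + hp (val i)).
  by apply: prodr_ge0 => i _; exact: le_trans (F1 _).
apply: ler_pM => //.
  pose k : 'I_n0 := ord_max.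
  have Ck (i : 'I_n0) : (i \in sieve_primes :\: sift_univ) && ~~ ((val i)%:R < z0) ->
      [/\ i = k, P i & z0 <= (val i)%:R].
    rewrite !inE -leNgt => /andP[/andP[h1 h2] h3].
    move: h1; rewrite h2 h3 /= -leNgt => zi.
    split=> //; last exact: set_mem.
    apply/val_inj/eqP; rewrite eqn_leq -ltnS ltn_ord /= -ltnS.
    rewrite truncn_lt_nat ?(le_trans _ z1) //; apply: le_lt_trans zi _.
    by rewrite ltr_nat.
  have [|h] := boolP [exists i : 'I_n0,
      (i \in sieve_primes :\: sift_univ) && ~~ ((val i)%:R < z0)].
    case/existsP => i Ci; have [ik Pi zi] := Ck i Ci.
    rewrite (big_pred1 i) => [|j]; first by have := hp1 _ Pi zi; lra.
    by apply/idP/eqP => [/Ck[-> _ _]|->].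
  rewrite big_pred0 ?ler1n // => i; apply/negbTE.
  by move: h; rewrite negb_exists => /forallP.
set D := [set p : nat | P p /\ p%:R < z0].
have finD : finite_set D.
  apply: sub_finite_set (finite_II (Num.truncn z0).+1) => p [_ pz] /=.
  by rewrite ltnS truncn_ge_nat // ltW.
rewrite /V fsbig_finite // -/D.
have -> : \prod_(p <- fset_set D) (1 - (lambda L p)%:R / p%:R)^-1 =
    \prod_(p <- fset_set D) (1 + hp p).
  rewrite big_seq [RHS]big_seq; apply: eq_bigr => p.
  rewrite in_fset_set // => /set_mem[Pp _].
  exact: V_factorE.
rewrite -big_enum /= -(big_map val predT (fun p => 1 + hp p)).
apply: ler_prod_sub_seq => //; [|exact: fset_uniq|].
  by rewrite map_inj_uniq ?enum_uniq //; exact: val_inj.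
move=> p /mapP[k]; rewrite mem_enum => /andP[/setDP[+ _] kz] ->.
rewrite finset.in_set => /set_mem Pk.
by rewrite in_fset_set // inE.
Qed.

Lemma G_le_V_mass : 2 <= z0 -> (forall p, P p -> z0 <= p%:R -> hp p <= 1) ->
  G P L z <= 2 * V P L z0 * sift_mass.
Proof.
move=> z02 hp1; apply: le_trans G_le_sum_sets _; apply: le_trans sum_sets_le _.
rewrite mulrC ler_wpM2r ?prod_complement_le //.
by apply: sumr_ge0 => J _; apply: prodr_ge0 => i _; exact: h_prime_ge0.
Qed.

End Level.
End SieveMass.

(** * Quadratic forms weighted by Fejer sums *)

Section Duality.
Variables (R : realType) (T : finType) (x : T -> RmodZ R).
Implicit Types (f : T -> R[i]).
Local Notation normc := (@Normc.normc R).

Definition trig_sum f (m : nat) : R[i] := \sum_b f b * e (x b *+ m).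

Lemma trig_sum_conj f m :
  (trig_sum f m)^*%C = \sum_b (f b)^*%C * e (- (x b *+ m)).
Proof.
by rewrite rmorph_sum; apply: eq_bigr => b _; rewrite rmorphM /= eN.
Qed.

(** The cross terms f(b) conj f(c) see only the difference of the two
    frequencies. *)
Lemma fejer_quadratic_form f (H : nat) (w : nat -> R) :
  ((\sum_(j < H) \sum_(k < H) w (j + k)%N * normc (trig_sum f (j + k)) ^+ 2)%:C)%C =
  \sum_b \sum_c f b * (f c)^*%C * fejer_sum H (fun m => (w m)%:C%C) (x b - x c).
Proof.
rewrite /fejer_sum rmorph_sum /=; under eq_bigr => j _ do rewrite rmorph_sum /=.
rewrite pair_big [RHS]pair_big /=.
under [RHS]eq_bigr => p _ do rewrite pair_big mulr_sumr.
rewrite exchange_big /=; apply: eq_bigr => -[j k] _ /=.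
rewrite rmorphM /= sqr_normc_conj trig_sum_conj /trig_sum mulr_suml mulr_sumr.
under [LHS]eq_bigr => b _ do rewrite !mulr_sumr.
rewrite pair_big /=; apply: eq_bigr => -[b c] _ /=.
by rewrite mulrnBl eD; ring.
Qed.

(** From a(b) a(c) <= (a(b)^2 + a(c)^2) / 2. *)
Lemma schur_test (a : T -> R) (M : T -> T -> R) (C : R) :
  (forall b c, 0 <= M b c) -> (forall b, \sum_c M b c <= C) ->
  (forall c, \sum_b M b c <= C) ->
  \sum_b \sum_c a b * a c * M b c <= C * \sum_b a b ^+ 2.
Proof.
move=> M0 h1 h2.
apply: (@le_trans _ _ (\sum_b \sum_c (a b ^+ 2 / 2 * M b c + a c ^+ 2 / 2 * M b c))).
  apply: ler_sum => b _; apply: ler_sum => c _; rewrite -mulrDl ler_wpM2r //.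
  by have := sqr_ge0 (a b - a c); rewrite !expr2; nra.
under eq_bigr => b _ do rewrite big_split /=.
rewrite big_split /= [X in _ + X]exchange_big /=.
have half (M' : T -> T -> R) : (forall b, \sum_c M' b c <= C) ->
    \sum_b \sum_c a b ^+ 2 / 2 * M' b c <= C / 2 * \sum_b a b ^+ 2.
  move=> h; rewrite mulr_sumr; apply: ler_sum => b _; rewrite -mulr_sumr.
  have a2 : 0 <= a b ^+ 2 / 2 by rewrite divr_ge0 ?sqr_ge0.
  by have := ler_wpM2l a2 (h b); lra.
have := half M h1; have := half (fun c b => M b c) h2; lra.
Qed.

(** The part of the transform that decays like the kernel is controlled by rows
    and columns and costs the l2 norm of f; a uniform remainder E can only be
    bounded trivially and costs the l1 norm. *)
Lemma fejer_quadratic_form_le f (H : nat) (w : nat -> R) (a C E : R) :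
  0 <= a ->
  (forall y, normc (fejer_sum H (fun m => (w m)%:C%C) y) <=
     a * normc (dirichlet H y) ^+ 2 + E) ->
  (forall b, \sum_c normc (dirichlet H (x b - x c)) ^+ 2 <= C) ->
  (forall c, \sum_b normc (dirichlet H (x b - x c)) ^+ 2 <= C) ->
  \sum_(j < H) \sum_(k < H) w (j + k)%N * normc (trig_sum f (j + k)) ^+ 2 <=
  a * C * (\sum_b normc (f b) ^+ 2) + E * (\sum_b normc (f b)) ^+ 2.
Proof.
move=> a0 hw h1 h2.
apply: le_trans (ler_norm _) _; rewrite -normc_real fejer_quadratic_form.
apply: (@le_trans _ _ (\sum_b \sum_c (a * (normc (f b) * normc (f c) *
    normc (dirichlet H (x b - x c)) ^+ 2) + E * (normc (f b) * normc (f c))))).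
  apply: le_trans (normc_sum _ _ _) _; apply: ler_sum => b _.
  apply: le_trans (normc_sum _ _ _) _; apply: ler_sum => c _.
  rewrite !Normc.normcM normc_conj.
  apply: le_trans (ler_wpM2l _ (hw _)) _; first by rewrite mulr_ge0 ?normc_ge0.
  by rewrite le_eqVlt; apply/orP; left; apply/eqP; ring.
under eq_bigr => b _ do rewrite big_split /= -!mulr_sumr.
rewrite big_split /= -!mulr_sumr; apply: lerD.
  rewrite -mulrA ler_wpM2l //.
  by apply: schur_test => // b c; rewrite exprn_ge0 ?normc_ge0.
by rewrite expr2 mulr_suml.
Qed.

End Duality.

(** * The Selberg majorant *)

Section Majorant.
Variables (R : realType) (P : set nat) (L : forall p : nat, {set 'Z_p}).
Hypothesis sd : sieve_data P L.
Variables (z z0 eps : R) (s H : nat).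
Hypothesis z1 : 1 <= z.
Hypothesis eps0 : 0 <= eps.
Hypothesis eps1 : eps <= 1.
Local Notation hp := (h_prime R P L).
Local Notation normc := (@Normc.normc R).
Hypothesis hp_eps : forall p, P p -> z0 <= p%:R -> 4 * hp p <= eps.
Local Notation n0 := (Num.truncn z).+1.
Local Notation univ := (sift_univ P z z0).
Local Notation adm := (sift_adm P (z := z) z0).
Local Notation mass := (sift_mass P L z z0).
Local Notation W := (square_weight adm (fun i : 'I_n0 => hp (val i))).

(** Indexed by sets of primes instead of squarefree integers. *)
Definition selberg_sum (m : nat) : R :=
  \sum_(J | adm J) \prod_(i in J) local_detector R (L (val i)) s m.

Lemma sift_univ_ge (i : 'I_n0) : i \in univ -> P i /\ z0 <= (val i)%:R.
Proof. by rewrite finset.in_set => /and3P[/set_mem]. Qed.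

Lemma sift_univ01 (i : 'I_n0) : i \in univ -> 0 <= hp (val i) <= 1.
Proof.
move=> /sift_univ_ge[Pi zi]; rewrite h_prime_ge0 //=.
apply: le_trans (le_trans (hp_eps Pi zi) eps1).
by rewrite ler_peMl ?h_prime_ge0 // ler1n.
Qed.

Lemma sift_mass_ge1 : 1 <= mass.
Proof.
apply: (adm_mass_ge1 (univ := univ)); first exact: sift_adm_univ.
  exact: sift_univ01.
exact: sift_adm0.
Qed.

Lemma selberg_sum_sqr m : selberg_sum m ^+ 2 =
  \sum_(Q | W Q != 0) W Q * \prod_(i in Q) local_detector R (L (val i)) s m.
Proof.
(* Off the sieving primes h vanishes, and 0 obeys the same quadratic rule. *)
pose g (i : 'I_n0) : R :=
  if val i \in P then local_detector R (L (val i)) s m else 0.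
have gE (J : {set 'I_n0}) : J \subset univ ->
    \prod_(i in J) local_detector R (L (val i)) s m = \prod_(i in J) g i.
  move=> Ju; apply: eq_bigr => i /(fintype.subsetP Ju)/sift_univ_ge[Pi _].
  by rewrite /g mem_set.
have -> : selberg_sum m = \sum_(J | adm J) \prod_(i in J) g i.
  by apply: eq_bigr => J /sift_adm_univ; exact: gE.
rewrite (square_expansion adm (h := fun i : 'I_n0 => hp (val i))); last first.
  move=> i; rewrite /g; case: ifP => [/set_mem Pi|iP].
    by rewrite h_primeE // local_detector_sqr.
  by rewrite /h_prime iP expr0n /= mulr0 addr0.
rewrite [RHS]big_mkcond; apply: eq_bigr => Q _.
case: eqP => [->|/eqP/square_weight_supp[J [J' [aJ aJ' QJ]]]]; first by rewrite mul0r.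
rewrite /= gE //; apply: fintype.subset_trans QJ _.
by rewrite finset.subUset !sift_adm_univ.
Qed.

Definition prime_seq (Q : {set 'I_n0}) : seq nat := [seq val i | i <- enum Q].

Lemma big_prime_seq (S : Type) (idx : S) (op : Monoid.com_law idx) (F : nat -> S)
  (Q : {set 'I_n0}) : \big[op/idx]_(p <- prime_seq Q) F p =
    \big[op/idx]_(i in Q) F (val i).
Proof. by rewrite /prime_seq big_map big_enum. Qed.

Lemma prime_seq_uniq Q : uniq (prime_seq Q).
Proof. by rewrite map_inj_uniq ?enum_uniq //; exact: val_inj. Qed.

(** Q lies in a union of two admissible sets, each of product at most z. *)
Lemma weight_supp (Q : {set 'I_n0}) : W Q != 0 ->
  Q \subset univ /\ (set_prod Q)%:R <= z ^+ 2.
Proof.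
move=> /square_weight_supp[J [J' [aJ aJ' QJ]]].
have [Ju J'u] := (sift_adm_univ aJ, sift_adm_univ aJ').
have JJu : J :|: J' \subset univ by rewrite finset.subUset Ju J'u.
split; first exact: fintype.subset_trans QJ JJu.
have uP := sift_univ_sub P z z0.
apply: (@le_trans _ _ (set_prod J * set_prod J')%N%:R).
  rewrite ler_nat; apply: leq_trans (set_prod_sub sd _ QJ) _.
    exact: fintype.subset_trans JJu uP.
  rewrite /set_prod [X in (X <= _)%N](big_setID J) /=.
  rewrite (finset.setIidPr (finset.subsetUl J J')) finset.setDUl finset.setDv.
  rewrite finset.set0U.
  rewrite leq_mul2l; apply/orP; right.
  apply: (set_prod_sub sd) (subsetDl _ _); exact: fintype.subset_trans J'u uP.
rewrite natrM expr2; apply: ler_pM; rewrite ?ler0n //.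
  by case/andP: aJ.
by case/andP: aJ'.
Qed.

Lemma prime_seq_prime (Q : {set 'I_n0}) : Q \subset univ -> all prime (prime_seq Q).
Proof.
move=> Qu; apply/allP => p /mapP[k]; rewrite mem_enum => kQ ->.
exact: (sieve_prime sd (sift_univ_ge (fintype.subsetP Qu _ kQ)).1).
Qed.

(** A prime of the sieve belongs to A exactly when it divides the product of
    A. *)
Lemma set_prod_inj (Q Q' : {set 'I_n0}) : Q \subset univ -> Q' \subset univ ->
  set_prod Q = set_prod Q' -> Q = Q'.
Proof.
have key (A : {set 'I_n0}) (i : 'I_n0) : A \subset univ -> prime (val i) ->
    (i \in A) = (val i %| set_prod A)%N.
  move=> Au pri; apply/idP/idP => [iA|].
    by rewrite /set_prod (bigD1 i) //= dvdn_mulr.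
  rewrite /set_prod Euclid_dvd_prod // big_has_cond => /hasP[k _ /andP[kA]].
  have prk : prime (val k) := sieve_prime sd (sift_univ_ge (fintype.subsetP Au _ kA)).1.
  by rewrite dvdn_prime2 // => /eqP/val_inj->.
move=> Qu Q'u E; apply/setP => i; apply/idP/idP => iQ.
  have pri := sieve_prime sd (sift_univ_ge (fintype.subsetP Qu _ iQ)).1.
  by move: iQ; rewrite !key // E.
have pri := sieve_prime sd (sift_univ_ge (fintype.subsetP Q'u _ iQ)).1.
by move: iQ; rewrite !key // E.
Qed.

Definition sieve_freqs : seq (RmodZ R) :=
  [seq t | Q <- enum (fun Q => W Q != 0), t <- freqs R (prime_seq Q)].

(** The exact order of t in R/Z is the only property of the frequencies used to
    separate them. *)
Lemma sieve_freqsP t : t \in sieve_freqs -> exists Q : {set 'I_n0}, [/\ Q \subset univ,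
  (0 < set_prod Q)%N, (set_prod Q)%:R <= z ^+ 2, t \in freqs R (prime_seq Q) &
  forall n, (t *+ n == 0) = (set_prod Q %| n)%N].
Proof.
case/allpairsPdep => Q [t' [+ tQ ->]]; rewrite mem_enum => /weight_supp[Qu Qz].
exists Q; split=> // [|n].
  apply: prodn_cond_gt0 => i iQ.
  exact: prime_gt0 (sieve_prime sd (sift_univ_ge (fintype.subsetP Qu _ iQ)).1).
by rewrite (freqs_order _ _ _ tQ) ?prime_seq_prime ?prime_seq_uniq // big_prime_seq.
Qed.

(** Frequencies attached to two sets have orders the products of these sets, so
    a common frequency forces the sets to coincide. *)
Lemma sieve_freqs_uniq : uniq sieve_freqs.
Proof.
have uQ := enum_uniq (fun Q => W Q != 0); rewrite /sieve_freqs.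
have : {in enum (fun Q => W Q != 0), forall Q : {set 'I_n0}, Q \subset univ}.
  by move=> Q; rewrite mem_enum => /weight_supp[].
elim: (enum _) uQ => //= Q l IH /andP[Ql ul] lu.
rewrite cat_uniq map_id freqs_uniq ?prime_seq_prime ?prime_seq_uniq ?lu ?mem_head //=.
rewrite IH ?andbT => [|//|Q' Q'l]; last by apply: lu; rewrite inE Q'l orbT.
apply/hasPn => t /allpairsPdep[Q' [t' [Q'l tQ' ->]]]; apply: contra Ql => tQ.
have Qu : Q \subset univ by rewrite lu ?mem_head.
have Q'u : Q' \subset univ by rewrite lu // inE Q'l orbT.
have o n : (t' *+ n == 0) = (set_prod Q %| n)%N.
  by rewrite (freqs_order _ _ _ tQ) ?prime_seq_prime ?prime_seq_uniq // big_prime_seq.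
have o' n : (t' *+ n == 0) = (set_prod Q' %| n)%N.
  by rewrite (freqs_order _ _ _ tQ') ?prime_seq_prime ?prime_seq_uniq // big_prime_seq.
suff -> : Q = Q' by [].
apply: set_prod_inj => //; apply/eqP; rewrite eqn_dvd.
by rewrite -o o' dvdnn -o' o dvdnn.
Qed.

(** The difference is killed by the product of the two denominators, each at
    most z^2. *)
Lemma sieve_freqs_spaced t t' : t \in sieve_freqs -> t' \in sieve_freqs ->
  t != t' -> z ^- 4 <= circle_norm (t - t').
Proof.
move=> /sieve_freqsP[Q [Qu Q0 Qz _ o]] /sieve_freqsP[Q' [Q'u Q'0 Q'z _ o']] tt'.
apply: (@le_trans _ _ ((set_prod Q * set_prod Q')%N%:R^-1)).
  rewrite lef_pV2 ?posrE ?ltr0n ?muln_gt0 ?Q0 // ?exprn_gt0 ?(lt_le_trans _ z1) //.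
  rewrite natrM (_ : 4 = 2 + 2)%N // exprD.
  by apply: ler_pM; rewrite ?ler0n.
apply: circle_norm_torsion; rewrite ?muln_gt0 ?Q0 ?subr_eq0 //.
rewrite mulrnBl; have /eqP-> : t *+ (set_prod Q * set_prod Q') == 0.
  by rewrite o dvdn_mulr.
have /eqP-> : t' *+ (set_prod Q * set_prod Q') == 0 by rewrite o' dvdn_mull.
by rewrite subrr.
Qed.

Lemma sieve_freqs_sum y : (0 < H)%N ->
  \sum_(t <- sieve_freqs) normc (dirichlet H (y + t)) ^+ 2 <=
  16 * H%:R * (H%:R + z ^+ 4).
Proof.
move=> H0.
rewrite -(big_map (fun t => y + t) predT (fun t => normc (dirichlet H t) ^+ 2)).
rewrite -[z ^+ 4]invrK; apply: dirichlet_sum_spaced => //.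
- by rewrite invr_gt0 exprn_gt0 // (lt_le_trans _ z1).
- by rewrite map_inj_uniq ?sieve_freqs_uniq //; exact: addrI.
move=> u v /mapP[t tf ->] /mapP[t' tf' ->] uv.
rewrite opprD addrACA subrr add0r; apply: sieve_freqs_spaced => //.
by apply: contra uv => /eqP->.
Qed.

(** The factor 4^|Q| is absorbed in the product of the 4 h(p), in which one factor
    is at most eps and the others at most 1. *)
Lemma weight_prod_le (Q : {set 'I_n0}) : Q \subset univ -> Q != finset.set0 ->
  `|W Q| * \prod_(i in Q) hp (val i) <= eps * mass.
Proof.
move=> Qu Q0.
have mass0 : 0 <= mass by apply: le_trans sift_mass_ge1.
have h0 i : 0 <= hp i := h_prime_ge0 R sd i.
have hQ (i : 'I_n0) : i \in Q -> 4 * hp (val i) <= eps.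
  by move=> /(fintype.subsetP Qu)/sift_univ_ge[Pi zi]; exact: hp_eps.
have h2 : `|W Q| <= 4 ^+ #|Q| * mass.
  apply: (square_weight_le (univ := univ)).
  - exact: sift_adm_univ.
  - by move=> J D; exact: (sift_adm_sub sd).
  - exact: sift_univ01.
apply: le_trans (ler_wpM2r _ h2) _; first by apply: prodr_ge0.
rewrite mulrAC ler_wpM2r //.
rewrite -prodr_const -big_split /=.
case/set0Pn: Q0 => k kQ; rewrite (bigD1 k) //=.
rewrite -[leRHS]mulr1; apply: ler_pM; rewrite ?mulr_ge0 ?prodr_ge0 //.
- by move=> i _; rewrite mulr_ge0.
- exact: hQ.
apply: prodr_ile1 => i /andP[iQ _]; rewrite mulr_ge0 //=.
exact: le_trans (hQ i iQ) eps1.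
Qed.

(** The first term comes from the empty set, with its exact coefficient; the
    second gathers all other sets, uniformly in y. *)
Lemma selberg_fejer_sum_le y : (0 < H)%N ->
  normc (fejer_sum H (fun m => (selberg_sum m ^+ 2)%:C%C) y) <=
  mass * normc (dirichlet H y) ^+ 2 +
  eps * mass * (16 * H%:R * (H%:R + z ^+ 4)).
Proof.
move=> H0.
have mass0 : 0 <= mass by apply: le_trans sift_mass_ge1.

have em0 : 0 <= eps * mass by rewrite mulr_ge0.
pose hs (Q : {set 'I_n0}) : R := \prod_(i in Q) hp (val i).
have hs0 Q : 0 <= hs Q by apply: prodr_ge0 => i _; exact: h_prime_ge0.
have gE m : selberg_sum m ^+ 2 = \sum_(Q | W Q != 0) W Q *
    \prod_(p <- prime_seq Q) local_detector R (L p) s m.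
  rewrite selberg_sum_sqr; apply: eq_bigr => Q _.
  by rewrite (big_prime_seq _ (fun p => local_detector R (L p) s m)).
have -> : (fun m => (selberg_sum m ^+ 2)%:C%C) = (fun m => (\sum_(Q | W Q != 0) W Q *
    \prod_(p <- prime_seq Q) local_detector R (L p) s m)%:C%C).
  by apply: funext => m; rewrite gE.
rewrite fejer_sum_sum.
apply: le_trans (normc_sum _ _ _) _.
have term (Q : {set 'I_n0}) : W Q != 0 -> normc ((W Q)%:C%C * fejer_sum H
    (fun m => (\prod_(p <- prime_seq Q) local_detector R (L p) s m)%:C%C) y) <=
    `|W Q| * hs Q * \sum_(t <- freqs R (prime_seq Q)) normc (dirichlet H (y + t)) ^+ 2.
  move=> WQ; have [Qu _] := weight_supp WQ.
  rewrite Normc.normcM normc_real -mulrA ler_wpM2l // /hs -(big_prime_seq _ hp).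
  apply: (@fejer_sum_freqs _ H (fun p m => local_detector R (L p) s m)).
  move=> p /mapP[k]; rewrite mem_enum => kQ ->.
  have [Pk _] := sift_univ_ge (fintype.subsetP Qu _ kQ).
  rewrite h_primeE //.
  by apply: local_detector_fourier;
      [exact: (sieve_prime sd Pk)|exact: (lambda_lt sd Pk)].
have D0 x : 0 <= normc (dirichlet H x) ^+ 2 by rewrite exprn_ge0 ?normc_ge0.
apply: (@le_trans _ _ (\sum_(Q : {set 'I_n0} | W Q != 0)
  ((if Q == finset.set0 then mass * normc (dirichlet H y) ^+ 2 else 0) +
  eps * mass * \sum_(t <- freqs R (prime_seq Q)) normc (dirichlet H (y + t)) ^+ 2))).
  apply: ler_sum => Q WQ; apply: le_trans (term Q WQ) _.
  have [Qu _] := weight_supp WQ.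
  case: eqP => [->|/eqP Q0]; last first.
    rewrite add0r ler_wpM2r ?weight_prod_le //.
    by apply: sumr_ge0 => t _.
  rewrite /hs big_set0 square_weight0 mulr1 ger0_norm //.
  rewrite /prime_seq enum_set0 /= !big_seq1 addr0 lerDl mulr_ge0 //.
rewrite big_split /= -mulr_sumr; apply: lerD.
  rewrite -big_mkcondr /= big_andbC.
  rewrite (big_pred1 finset.set0) // => Q /=.
  case: (eqVneq Q finset.set0) => //= ->; rewrite square_weight0.
  by rewrite gt_eqF // (lt_le_trans ltr01) // sift_mass_ge1.
rewrite ler_wpM2l //; apply: le_trans (sieve_freqs_sum y H0).
rewrite /sieve_freqs big_allpairs_dep /= big_enum /=.
by [].
Qed.


End Majorant.

(** * The weighted sum over the sifted set *)

(** The arithmetic that ends the proof, with h = 2 s + 1 the length of the kernel: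
    h <= 2 (s + 1), while 2 h + d + Z <= 7 (N + d) because s <= N, Z <= N and
    1 <= N. *)
Lemma sifted_sum_arith (R : realFieldType) (N Z d s m S a n2 eps : R) :
  0 < m -> 1 <= Z -> Z <= N -> 0 <= s -> s <= N -> 0 < d -> 0 <= n2 ->
  eps * a <= n2 ->
  (s + 1) * (m ^+ 2 * S) <=
    m * (16 * (2 * s + 1) * (2 * s + 1 + d)) * n2 +
    eps * m * (16 * (2 * s + 1) * (2 * s + 1 + Z)) * a ->
  m * S <= 224 * (N + d) * n2.
Proof.
move=> m0 Z1 ZN s0 sN d0 n20 epsa; set h := 2 * s + 1 => hyp.
have h0 : 0 <= h by rewrite /h; lra.
have E0 : 0 <= m * (16 * h * (h + Z)).
  by rewrite mulr_ge0 ?(ltW m0) // mulr_ge0 ?mulr_ge0 //; lra.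
have step1 : (s + 1) * (m ^+ 2 * S) <= m * (16 * h * (2 * h + d + Z) * n2).
  by have := ler_wpM2l E0 epsa; lra.
have hn0 : 0 <= h * n2 by rewrite mulr_ge0.
have step2 : h * n2 * (2 * h + d + Z) <= h * n2 * (7 * (N + d)).
  by apply: ler_wpM2l => //; rewrite /h; lra.
have Nd0 : 0 <= n2 * (N + d) by rewrite mulr_ge0 //; lra.
have step3 : n2 * (N + d) * h <= n2 * (N + d) * (2 * (s + 1)).
  by apply: ler_wpM2l => //; rewrite /h; lra.
have sm0 : 0 < m * (s + 1) by rewrite mulr_gt0 //; lra.
rewrite -(ler_pM2l sm0).
have step4 : 16 * h * (2 * h + d + Z) * n2 <= (s + 1) * (224 * (N + d) * n2) by lra.
have := ler_wpM2l (ltW m0) step4; lra.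
Qed.

Section SiftedSum.
Variables (R : realType) (P : set nat) (L : forall p : nat, {set 'Z_p}).
Hypothesis sd : sieve_data P L.
Variables (z z0 eps N delta : R) (T : finType) (x : T -> RmodZ R) (f : T -> R[i]).
Hypothesis z1 : 1 <= z.
Hypothesis eps0 : 0 <= eps.
Hypothesis eps1 : eps <= 1.
Hypothesis N0 : 0 <= N.
Hypothesis delta0 : 0 < delta.
Hypothesis xinj : injective x.
Hypothesis xsp : forall b c, b != c -> delta <= circle_norm (x b - x c).
Local Notation hp := (h_prime R P L).
Local Notation normc := (@Normc.normc R).
Hypothesis hp_eps : forall p, P p -> z0 <= p%:R -> 4 * hp p <= eps.
Local Notation mass := (sift_mass P L z z0).
Local Notation s := (Num.truncn N).
Local Notation H := (s.*2.+1).
Local Notation A := (selberg_sum P L z z0 s).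
Local Notation norm1T := (\sum_b normc (f b)).
Local Notation norm2T := (\sum_b normc (f b) ^+ 2).

Lemma selberg_sum_sifted n : sifted P L N z n -> A (n + s) = mass.
Proof.
case=> n0 nN nL; apply: eq_bigr => J /sift_adm_univ Ju.
apply: eq_bigr => i /(fintype.subsetP Ju).
rewrite finset.in_set => /and3P[/set_mem Pi _ iz].
by rewrite h_primeE // /local_detector natrD addrK (negbTE (nL _ Pi iz)).
Qed.

Lemma finite_sifted : finite_set (sifted P L N z).
Proof.
apply: sub_finite_set (finite_II s.+1) => n [_ nN _] /=.
by rewrite ltnS truncn_ge_nat.
Qed.

(** For n <= N and each j <= s, the integer n + s is j + k for some k < H.  Thus
    every sifted n is counted at least s + 1 times on the right. *)
Lemma sifted_sum_le_fejer (phi : nat -> R) : (forall m, 0 <= phi m) ->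
  s.+1%:R * \sum_(n \in sifted P L N z) phi (n + s)%N <=
  \sum_(j < H) \sum_(k < H) phi (j + k)%N.
Proof.
move=> phi0; rewrite fsbig_finite; last exact: finite_sifted.
have sH : (s.+1 <= H)%N by rewrite ltnS -addnn leq_addr.
apply: (@le_trans _ _ (\sum_(j < H | (j < s.+1)%N) \sum_(k < H) phi (j + k)%N)).
  rewrite -(big_ord_widen _ (fun j => \sum_(k < H) phi (j + k)%N) sH).
  have -> : s.+1%:R * \sum_(n <- fset_set (sifted P L N z)) phi (n + s)%N =
     \sum_(j < s.+1) \sum_(n <- fset_set (sifted P L N z)) phi (n + s)%N.
    by rewrite sumr_const card_ord mulr_natl.
  apply: ler_sum => j _.
  pose g (n : nat) : 'I_H := inord (n + s - j).
  have js : (j <= s)%N by rewrite -ltnS.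
  have gE n : n \in fset_set (sifted P L N z) -> (j + g n = n + s)%N.
    rewrite in_fset_set; last exact: finite_sifted.
    move=> /set_mem[_ nN _]; have ns : (n <= s)%N by rewrite truncn_ge_nat.
    rewrite /g inordK ?subnKC //; first by rewrite (leq_trans js) // leq_addl.
    rewrite ltnS -addnn; apply: leq_trans (leq_subr _ _) _.
    by rewrite leq_add2r.
  rewrite big_seq; under eq_bigr => n nD do rewrite -(gE n nD).
  rewrite -big_seq.
  apply: (@ler_sum_inj _ _ _ _ g predT (fun k : 'I_H => phi (j + k)%N)) => //.
    exact: fset_uniq.
  move=> n n' nD n'D E; apply/eqP; rewrite -(eqn_add2r s) -gE // -gE //.
  by rewrite E.
rewrite [leRHS](bigID (fun j : 'I_H => (j < s.+1)%N)) /= lerDl.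
by apply: sumr_ge0 => j _; apply: sumr_ge0.
Qed.

Lemma dirichlet_row_le (b : T) : \sum_c normc (dirichlet H (x b - x c)) ^+ 2 <=
  16 * H%:R * (H%:R + delta^-1).
Proof.
rewrite -big_enum /= -(big_map (fun c => x b - x c) predT
  (fun y => normc (dirichlet H y) ^+ 2)).
apply: dirichlet_sum_spaced => //.
  rewrite map_inj_uniq ?enum_uniq // => c c' /addrI/oppr_inj; exact: xinj.
move=> u v /mapP[c _ ->] /mapP[c' _ ->] uv.
rewrite opprB addrC addrA subrK; apply: xsp.
by apply: contra uv => /eqP->.
Qed.

Lemma dirichlet_col_le (c : T) : \sum_b normc (dirichlet H (x b - x c)) ^+ 2 <=
  16 * H%:R * (H%:R + delta^-1).
Proof.
rewrite -big_enum /= -(big_map (fun b => x b - x c) predT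
  (fun y => normc (dirichlet H y) ^+ 2)).
apply: dirichlet_sum_spaced => //.
  rewrite map_inj_uniq ?enum_uniq // => b b' /addIr; exact: xinj.
move=> u v /mapP[b _ ->] /mapP[b' _ ->] uv.
rewrite opprB addrA subrK; apply: xsp.
by apply: contra uv => /eqP->.
Qed.

(** The hypothesis on eps makes the l1 term as small as the l2 term. *)
Lemma sifted_sum_le : z ^+ 4 <= N -> eps * norm1T ^+ 2 <= norm2T ->
  mass * \sum_(n \in sifted P L N z) normc (trig_sum x f n) ^+ 2 <=
  224 * (N + delta^-1) * norm2T.
Proof.
move=> zN epsf.
have mass1 : 1 <= mass by apply: sift_mass_ge1 eps1 hp_eps.
have mass0 : 0 < mass by apply: lt_le_trans mass1.
(* Twisting f undoes the shift by s without changing any modulus. *)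
pose f' b := f b * e (- (x b *+ s)).
have f'E b : normc (f' b) = normc (f b) by rewrite Normc.normcM normc_e mulr1.
have FE n : trig_sum x f' (n + s) = trig_sum x f n.
  apply: eq_bigr => b _; rewrite /f' -mulrA -eD mulrnDr.
  by congr (_ * e _); rewrite addrC addrK.
pose phi m := A m ^+ 2 * normc (trig_sum x f' m) ^+ 2.
have phi0 m : 0 <= phi m by rewrite mulr_ge0 ?sqr_ge0.
have := sifted_sum_le_fejer phi0.
set S := \sum_(n \in _) normc _ ^+ 2.
have -> : \sum_(n \in sifted P L N z) phi (n + s)%N = mass ^+ 2 * S.
  rewrite /S !fsbig_finite; try exact: finite_sifted.
  rewrite mulr_sumr big_seq [RHS]big_seq; apply: eq_bigr => n.
  rewrite in_fset_set; last exact: finite_sifted.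
  by move=> /set_mem nS; rewrite /phi selberg_sum_sifted // FE.
move=> h1.
have h2 := @fejer_quadratic_form_le _ _ x f' H (fun m => A m ^+ 2) mass
  (16 * H%:R * (H%:R + delta^-1)) (eps * mass * (16 * H%:R * (H%:R + z ^+ 4))).
have z4 : 1 <= z ^+ 4 by rewrite exprn_ege1.
have n1E : \sum_b normc (f' b) = norm1T by apply: eq_bigr => b _.
have n2E : \sum_b normc (f' b) ^+ 2 = norm2T by apply: eq_bigr => b _; rewrite f'E.
rewrite n1E n2E in h2.
have {}h2 := h2 (ltW mass0)
  (fun y => selberg_fejer_sum_le sd s z1 eps0 eps1 hp_eps y (ltn0Sn _))
  dirichlet_row_le dirichlet_col_le.
have {h1 h2} := le_trans h1 h2.
have n20 : 0 <= norm2T by apply: sumr_ge0 => b _; exact: sqr_ge0.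
have sN : s%:R <= N by rewrite truncn_le.
have HE : H%:R = 2 * s%:R + 1 :> R by rewrite -addn1 natrD -muln2 natrM mulrC.
have sE : s.+1%:R = s%:R + 1 :> R by rewrite -addn1 natrD.
have s0 : 0 <= s%:R :> R by [].
have d0 : 0 < delta^-1 by rewrite invr_gt0.
rewrite HE sE => h.
exact: sifted_sum_arith mass0 z4 zN s0 sN d0 n20 epsf h.
Qed.

End SiftedSum.

(** * Choice of the parameters *)

Section SmallDensity.
Variables (R : realType).

Lemma sum_sqr_le (T : finType) (a : T -> R) : (forall b, 0 <= a b) ->
  \sum_b a b ^+ 2 <= (\sum_b a b) ^+ 2.
Proof.
move=> a0; rewrite [leRHS]expr2 mulr_suml; apply: ler_sum => b _.
by rewrite expr2 ler_wpM2l // (bigD1 b) //= lerDl sumr_ge0.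
Qed.

Lemma powR_quarterX (a : R) : 0 <= a -> (a `^ 4^-1) ^+ 4 = a.
Proof.
move=> a0; rewrite -powR_mulrn ?powR_ge0 // -powRrM mulVf // powRr1 //.
Qed.

Lemma G_ge1 (P : set nat) (L : forall p : nat, {set 'Z_p}) (z : R) :
  sieve_data P L -> 1 <= z -> 1 <= G P L z.
Proof.
move=> sd z1; rewrite /G; set D := [set m | _].
have finD : finite_set D.
  apply: sub_finite_set (finite_II (Num.truncn z).+1) => m [_ mz] /=.
  by rewrite ltn_level.
rewrite fsbig_finite // (big_fsetD1 1%N) /=; last first.
  by rewrite in_fset_set // inE.
rewrite h1 lerDl; apply: sumr_ge0 => m _; rewrite /h; case: ifP => // _.
by apply: prodr_ge0 => p _; exact: h_prime_ge0.
Qed.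

(** With q = p^(1/4), the bound on p gives (5 r M)^2 <= p, and q^2 <= p, so that
    5 r lambda <= 5 r M q <= p.  As r >= 1, it follows that
    4 r lambda <= p - lambda. *)
Lemma h_prime_small (P : set nat) (L : forall p : nat, {set 'Z_p}) (M r : R)
    (B p : nat) :
  sieve_data P L -> 0 < M -> 1 <= r -> 25 * M ^+ 2 <= 2 ^+ B -> P p ->
  (lambda L p)%:R <= M * p%:R `^ 4^-1 -> (2 * r) ^+ (2 + B) <= p%:R ->
  4 * h_prime R P L p <= r^-1.
Proof.
move=> sd M0 r1 MB Pp lM zp.
have r0 : 0 < r by exact: lt_le_trans r1.
have lp := lambda_lt sd Pp.
have p0 : (0 < p)%N := prime_gt0 (sieve_prime sd Pp).
set q := p%:R `^ 4^-1 in lM.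
have q0 : 0 <= q by exact: powR_ge0.
have q4 : q ^+ 4 = p%:R by apply: powR_quarterX.
have q1 : 1 <= q.
  rewrite -(ler_pXn2r (n := 4)) ?nnegrE //.
  by rewrite q4 expr1n ler1n.
have q2 : q ^+ 2 <= p%:R.
  by rewrite -q4 ler_weXn2l.
have rM : 25 * M ^+ 2 * r ^+ 2 <= p%:R.
  apply: le_trans zp; rewrite exprD.
  have h2 : 2 ^+ B <= (2 * r) ^+ B.
    by rewrite lerXn2r ?nnegrE ?mulr_ge0 ?(ltW r0) // ler_peMr.
  have h3 : r ^+ 2 <= (2 * r) ^+ 2.
    by rewrite ler_pXn2r ?nnegrE ?mulr_ge0 ?(ltW r0) // ler_peMl ?(ltW r0) // ler1n.
  rewrite mulrC; apply: ler_pM => //; first by rewrite exprn_ge0 // ltW.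
    by rewrite mulr_ge0 ?sqr_ge0.
  exact: le_trans MB h2.
have key : 5 * r * M * q <= p%:R.
  rewrite -(ler_pXn2r (n := 2)) ?nnegrE ?mulr_ge0 ?(ltW r0) ?(ltW M0) //.
  have -> : (5 * r * M * q) ^+ 2 = (25 * M ^+ 2 * r ^+ 2) * q ^+ 2 by ring.
  rewrite [leRHS]expr2; apply: ler_pM rM q2; last exact: sqr_ge0.
  by apply: mulr_ge0; [apply: mulr_ge0; [|exact: sqr_ge0]|exact: sqr_ge0].
have l0 : 0 <= (lambda L p)%:R :> R by [].
have key2 : 5 * r * (lambda L p)%:R <= p%:R.
  apply: le_trans key; rewrite -[leRHS]mulrA ler_wpM2l // mulr_ge0 // ltW //.
rewrite h_primeE // /local_density -/(lambda L p).
have d0 : 0 < p%:R - (lambda L p)%:R :> R by rewrite subr_gt0 ltr_nat.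
rewrite mulrA ler_pdivrMr // [r^-1 * _]mulrC ler_pdivlMr //.
by have := ler_peMl l0 r1; lra.
Qed.

End SmallDensity.

Theorem theorem1p3 (R : realType) (kappa T M : R)
    (kappa_gt0 : 0 < kappa) (T_gt0 : 0 < T) (M_gt0 : 0 < M) :
  exists K : R,
    forall (P : set nat) (L : forall p : nat, {set 'Z_p}),
      sieve_data P L ->
      (forall p : nat, P p -> (lambda L p)%:R <= M * p%:R `^ 4^-1) ->
      (forall y : R, 2 <= y -> V P L y <= T * ln y `^ kappa) ->
    forall N z : R, 0 < N -> 0 < z -> 1 <= z -> z <= N `^ 4^-1 ->
    forall (delta : R) (B : {fset RmodZ R}),
      0 < delta -> well_spaced delta B ->
    forall f : B -> R[i], (exists b : B, f b != 0) ->
      \sum_(n \in sifted P L N z)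
          Normc.normc (\sum_(b : B) f b * e (val b *+ n)) ^+ 2
      <= K * ((N + delta^-1) / G P L z)
           * ln (2 * (norm1 f ^+ 2 / norm2_sq f)) `^ kappa
           * norm2_sq f.
Proof.
(* 2 ^ k >= 25 M ^ 2 is what h_prime_small needs of the exponent 2 + k. *)
pose k := (Num.truncn (25 * M ^+ 2)).+1.
have Mk : 25 * M ^+ 2 <= 2 ^+ k.
  apply: le_trans (ltW (truncnS_gt _)) _.
  by rewrite -natrX ler_nat ltnW // ltn_expl.
exists (448 * T * (2 + k)%:R `^ kappa)
  => P L sd lM VT N z N0 z0 z1 zN delta B d0 sp f [b0 fb0].
set n1 := norm1 f; set n2 := norm2_sq f.
have n20 : 0 < n2.
  rewrite /n2 /norm2_sq (bigD1 b0) //= ltr_wpDr //.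
    by apply: sumr_ge0 => b _; rewrite exprn_ge0 ?normc_ge0.
  rewrite exprn_gt0 // lt_neqAle normc_ge0 andbT eq_sym.
  by apply: contra fb0 => /eqP/Normc.eq0_normc ->.
have n12 : n2 <= n1 ^+ 2 by apply: sum_sqr_le => b; exact: normc_ge0.
set r := n1 ^+ 2 / n2.
have r1 : 1 <= r by rewrite /r ler_pdivlMr // mul1r.
have r0 : 0 < r by exact: lt_le_trans r1.
(* The level z0 below which primes are left out of the majorant. *)
pose w := (2 * r) ^+ (2 + k).
have r2 : 2 <= 2 * r by rewrite ler_peMr.
have w2 : 2 <= w.
  apply: le_trans (r2) _; rewrite -[leLHS]expr1 ler_weXn2l //.
  by apply: le_trans (r2); rewrite ler1n.
have small p : P p -> w <= p%:R -> 4 * h_prime R P L p <= r^-1.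
  by move=> Pp; apply: h_prime_small Mk Pp (lM p Pp).
have rV1 : r^-1 <= 1 by rewrite invf_le1.
have hp1 p : P p -> w <= p%:R -> h_prime R P L p <= 1.
  move=> Pp wp; apply: le_trans (le_trans (small p Pp wp) rV1).
  by rewrite ler_peMl ?h_prime_ge0 // ler1n.
have zN4 : z ^+ 4 <= N.
  rewrite -[leRHS]powR_quarterX ?(ltW N0) // ler_pXn2r ?nnegrE ?powR_ge0 //.
  exact: ltW.
have spv (b c : B) : b != c -> delta <= circle_norm (val b - val c).
  by move=> bc; apply: sp; rewrite ?fsvalP //; apply: contra bc => /eqP/val_inj->.
have rV0 : 0 <= r^-1 by rewrite invr_ge0 ltW.
have epsf : r^-1 * n1 ^+ 2 <= n2.
  rewrite /r invf_div mulrAC -mulrA divff ?mulr1 //.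
  by rewrite gt_eqF // (lt_le_trans n20).
have main := @sifted_sum_le R P L sd z w r^-1 N delta B val f z1 rV0 rV1 (ltW N0) d0
  val_inj spv small zN4 epsf.
have GV := G_le_V_mass sd z1 w2 hp1.
have G1 := G_ge1 sd z1.
have Vw := VT w w2.
have lw : ln w `^ kappa = (2 + k)%:R `^ kappa * ln (2 * r) `^ kappa.
  rewrite /w lnXn; last by apply: lt_le_trans (r2).
  rewrite -[ln _ *+ _]mulr_natl powRM //; apply: ln_ge0.
  by apply: le_trans (r2); rewrite ler1n.
rewrite lw in Vw.
have main2 : G P L z <= 2 * (T * ((2 + k)%:R `^ kappa * ln (2 * r) `^ kappa)) *
    sift_mass P L z w.
  apply: le_trans GV _; rewrite ler_wpM2r ?ler_wpM2l //.
  exact: le_trans ler01 (sift_mass_ge1 sd z1 rV1 small).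
move: main main2; set m := sift_mass P L z w.
rewrite /trig_sum -/n2 -[\sum_b _ ^+ 2]/n2.
set S := \sum_(n \in _) _; set l := ln (2 * r) `^ kappa; set K := _ `^ kappa.
set g := G P L z in G1 *; set d := delta^-1 => main main2.
have g0 : 0 < g by apply: lt_le_trans G1.
have S0 : 0 <= S.
  rewrite /S fsbig_finite; last exact: finite_sifted (ltW N0).
  by apply: sumr_ge0 => n _; rewrite exprn_ge0 ?normc_ge0.
have -> : 448 * T * K * ((N + d) / g) * l * n2 =
    (2 * (T * (K * l)) * (224 * (N + d) * n2)) / g by field; rewrite gt_eqF.
rewrite ler_pdivlMr // mulrC; apply: le_trans (ler_wpM2r S0 main2) _.
by rewrite -(mulrA _ m S) ler_wpM2l // !mulr_ge0 ?powR_ge0 // ltW.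
Qed.
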